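(* Let $\alpha\in(0,1)\cup(1,2)$ and let $F$ be a probability on $\mathbb{R}$ such that, for some $A\in RV(\alpha)$ and some $p>0$, $q\ge 0$, $$\overline F(x)\sim \frac{p}{A(x)},\qquad F(-x)\sim\frac{q}{A(x)}\qquad (x\to\infty),$$ (where for $q=0$ the second relation means $F(-x)=o(1/A(x))$). If $\alpha>1$, assume moreover that $\mathbb{E}[X_1]=0$. Let $(X_i)_{i\in\mathbb{N}}$ be i.i.d. with law $F$, $S_n=X_1+\dots+X_n$, $M_n=\max\{X_1,\dots,X_n\}$, and $a_n=A^{-1}(n)$. Fix a bounded measurable set $J\subseteq\mathbb{R}$. Then for every $\gamma\in(0,\infty)$ there is a constant $C_0=C_0(\gamma,J)<\infty$ such that, for all $n\in\mathbb{N}$ and $x\ge 0$, $$\mathbb{P}(S_n\in x+J,\ M_n\le\gamma x)\le C_0\,\frac1{a_n}\left(\frac{n}{A(x)}\right)^{\lceil 1/\gamma\rceil},$$ where $\lceil t\rceil:=\min\{m\in\mathbb{N}: m\ge t\}$; that is, for every $k\in\mathbb{N}$ and $\gamma\in[\frac1k,\frac1{k-1})$ (with $\frac10:=\infty$) the bound holds with exponent $k$. Moreover, there is a constant $C_0'=C_0'(J)<\infty$ such that, for all $n\in\mathbb{N}$ and $x\ge0$, $$\mathbb{P}(S_n\in x+J)\le C_0'\,\frac1{a_n}\,\frac{n}{A(x)}.$$ (The constants may also depend on $F$.)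
   Context: $\mathbb{N}=\{1,2,3,\dots\}$. $RV(\gamma)$ denotes the class of regularly varying functions with index $\gamma$: $f\in RV(\gamma)$ iff $f(x)=x^\gamma\ell(x)$ with $\ell$ slowly varying at infinity. $\overline F(x):=F((x,\infty))$, $F(x):=F((-\infty,x])$; $f\sim g$ means $f/g\to1$. Standing normalization of the paper (without loss of generality): $A:[0,\infty)\to(0,\infty)$ is differentiable, strictly increasing, $A'(s)\sim\alpha A(s)/s$ as $s\to\infty$, $A(0)=\frac12$ and $A(1)=1$; $A^{-1}$ is the inverse function of $A$. *)

(* Defs.v *)
From HB Require Import structures.
From mathcomp Require Import all_boot all_order all_algebra.
From mathcomp Require Import finmap.
From mathcomp Require Import all_classical all_reals all_analysis.

Set Implicit Arguments.
Unset Strict Implicit.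
Unset Printing Implicit Defensive.

Import Order.TTheory GRing.Theory Num.Theory.
Import numFieldNormedType.Exports.

Local Open Scope classical_set_scope.
Local Open Scope ring_scope.

Section RegularVariation.
Context {R : realType}.

Definition asymp_equiv (f g : R -> R) : Prop :=
  f x / g x @[x --> +oo] --> (1 : R).

Definition asymp_negligible (f g : R -> R) : Prop :=
  f x / g x @[x --> +oo] --> (0 : R).

Definition slowly_varying (l : R -> R) : Prop :=
  (exists a : R, measurable_fun `[a, +oo[ l /\
                 forall x, a <= x -> 0 < l x) /\
  forall t : R, 0 < t -> asymp_equiv (fun x => l (t * x)) l.

(* The class RV(gamma) only concerns the behaviour at infinity, hence the
   factorization is required for all large x. *)
Definition regularly_varying (gamma : R) (f : R -> R) : Prop :=
  exists2 l : R -> R, slowly_varying l &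
    \forall x \near +oo, f x = x `^ gamma * l x.

(* A function [0, +oo[ -> ]0, +oo[ is represented by a total function whose
   values on negative reals are irrelevant, so that differentiability at 0 is
   existence of the right derivative. *)
Record normalized_scale (alpha : R) (A : R -> R) : Prop := NormalizedScale {
  scale_gt0 : forall s : R, 0 <= s -> 0 < A s ;
  scale_derivable : forall s : R, 0 < s -> derivable A s 1 ;
  scale_derivable0 : cvg (h^-1 * (A h - A 0) @[h --> 0^'+]) ;
  scale_increasing : forall s t : R, 0 <= s -> s < t -> A s < A t ;
  scale_derive : asymp_equiv (derive1 A) (fun s => alpha * A s / s) ;
  scale_at0 : A 0 = 2^-1 ;
  scale_at1 : A 1 = 1
}.

(* The inverse of A : [0, +oo[ -> [1/2, +oo[; junk value outside the image. *)
Definition scale_inv (A : R -> R) : R -> R :=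
  'pinv_(fun=> 0) `[0, +oo[%classic A.

Definition translate (x : R) (J : set R) : set R := [set x + y | y in J].

End RegularVariation.

Section IID.
Context d (T : measurableType d) (R : realType) (P : probability T R).

(* X 0, X 1, ... stand for X_1, X_2, ... *)
Implicit Type X : nat -> {RV P >-> R}.

Definition mutually_independent X : Prop :=
  forall (I : {fset nat}) (B : nat -> set R),
    (forall i, measurable (B i)) ->
    P (\bigcap_(i in [set` I]) (X i @^-1` B i)) =
    (\prod_(i <- I) P (X i @^-1` B i))%E.

Definition iid (F : probability (measurableTypeR R) R) X : Prop :=
  mutually_independent X /\
  forall i (B : set R), measurable B -> distribution P (X i) B = F B.

Definition walk X (n : nat) (w : T) : R := \sum_(i < n) X i w.

(* For n >= 1 this is the maximum of X 0 w, ..., X (n - 1) w; the default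
   value X 0 w is one of the terms. *)
Definition running_max X (n : nat) (w : T) : R :=
  \big[Order.max/X 0%N w]_(i < n) X i w.

End IID.

(* Main.v *)
Require Import Defs.
From HB Require Import structures.
From mathcomp Require Import all_boot all_order all_algebra.
From mathcomp Require Import all_classical all_reals all_analysis.
From mathcomp Require Import finmap measurable_realfun ring lra.

Set Implicit Arguments.
Unset Strict Implicit.
Unset Printing Implicit Defensive.

Import Order.TTheory GRing.Theory Num.Theory.
Import numFieldNormedType.Exports.

Local Open Scope classical_set_scope.
Local Open Scope ring_scope.

(** The walk is studied through the operators
[step F w f s = E (w X * f (s + X))], [X] of law [F]: for the indicator [w]
of a set [C], the [n]-th iterate applied to the indicator of [U] is, at [0],
the probability that [S_n] lies in [U] and that all increments lie in [C]
(walk_law). These operators are positive and commute.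

Concentration. Uniformly in [x], the window [[x - h, x + h]] is charged by
[S_n] with probability at most [K / a_n] (concentration). The window is
dominated by a Fejer kernel, a sum of waves, and the operators act on waves
of frequency [t] through the characteristic function, whose modulus at
[t = pi / (2 * r)] is at most [1 - c / A r] because [F] charges
[]r, 2 * r]] with a mass of order [1 / A r]. With the discrete kernel of
[N ~ a_n] frequencies everything is a finite sum, bounded since
[n / A (a_n / m)] grows at least like a power of [m]. The weight [w] need not be [1],
only of total mass [1 + O(1 / n)] and bounded below near [0] and on
[[0, a_n]]; this leaves room for tilting.

Small increments. If all increments are at most [y], tilt by
[expR (lam * z)], where [expR (lam * y) = A y / n]. The tilted law has mass
[1 + O(1 / n)] (tilted_mass; for [alpha > 1] thanks to centering), so that
concentration applies to it, and undoing the tilt at [S_n ~ k * y] yields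
the bound [K / a_n * (n / A y) ^+ k] (truncated_local).

Big jumps. Otherwise some increment [z] exceeds [x / k]. By exchangeability
it may be taken first (iter_step_decomposition), at a cost [n / A x], and
the other increments are left with the distance [x - z]. Without constraint
on the maximum, concentration of the remaining walk yields exponent [1]
(local_deviation). Under the constraint [M_n <= gamma * x] the remaining
distance is at least [(1 - gamma) * x], so that the remaining walk is
constrained with the parameter [gamma / (1 - gamma)], whose inverse is
[1 / gamma - 1]: the exponent follows by induction
(truncated_local_deviation). *)

(** * Bounded measurable functions and their means *)

Section BoundedMeasurable.
Context d (T : measurableType d) (R : realType).
Implicit Types f g : T -> R.

Definition bmfun f : Prop :=
  measurable_fun [set: T] f /\ exists M : R, forall t, `|f t| <= M.

Lemma bmfun_cst (c : R) : bmfun (fun=> c).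
Proof. by split; [exact: measurable_cst | exists `|c|]. Qed.

Lemma bmfunD f g : bmfun f -> bmfun g -> bmfun (fun t => f t + g t).
Proof.
move=> [mf [M fM]] [mg [K gK]]; split; first exact: measurable_funD.
by exists (M + K) => t; rewrite (le_trans (ler_normD _ _))// lerD.
Qed.

Lemma bmfunM f g : bmfun f -> bmfun g -> bmfun (fun t => f t * g t).
Proof.
move=> [mf [M fM]] [mg [K gK]]; split; first exact: measurable_funM.
by exists (M * K) => t; rewrite normrM ler_pM.
Qed.

Lemma bmfunN f : bmfun f -> bmfun (fun t => - f t).
Proof.
move=> [mf [M fM]]; split; last by exists M => t; rewrite normrN.
exact: measurable_funN.
Qed.

Lemma bmfunB f g : bmfun f -> bmfun g -> bmfun (fun t => f t - g t).
Proof. by move=> bf bg; apply: bmfunD => //; exact: bmfunN. Qed.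

Lemma bmfun_sum (I : Type) (r : seq I) (h : I -> T -> R) :
  (forall i, bmfun (h i)) -> bmfun (fun t => \sum_(i <- r) h i t).
Proof.
move=> bh; elim: r => [|i r IH].
  rewrite (_ : (fun _ => _) = fun=> 0); first exact: bmfun_cst.
  by apply/funext => t; rewrite big_nil.
rewrite (_ : (fun _ => _) = fun t => h i t + \sum_(j <- r) h j t).
  exact: bmfunD.
by apply/funext => t; rewrite big_cons.
Qed.

Lemma bmfun_indic (B : set T) : measurable B -> bmfun (\1_B : T -> R).
Proof.
move=> mB; split; first exact: measurable_indic.
exists 1 => t; rewrite indicE.
by case: (_ \in _); rewrite ?normr1 ?normr0 ?ler01.
Qed.

Variable Q : {finite_measure set T -> \bar R}.

Definition mean f : R := \int[Q]_t f t.

Lemma bmfun_integrable f : bmfun f -> Q.-integrable [set: T] (EFin \o f).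
Proof.
move=> [mf [M fM]]; apply: measurable_bounded_integrable => //.
  by rewrite -ge0_fin_numE ?fin_num_measure.
exists M; split; first exact: num_real.
by move=> x Mx t _ /=; rewrite (le_trans (fM t))// ltW.
Qed.
Local Hint Resolve bmfun_integrable : core.

Lemma mean_ge0 f : (forall t, 0 <= f t) -> 0 <= mean f.
Proof. by move=> f0; exact: Rintegral_ge0. Qed.

Lemma le_mean f g : bmfun f -> bmfun g ->
  (forall t, f t <= g t) -> mean f <= mean g.
Proof. by move=> bf bg fg; apply: le_Rintegral; auto. Qed.

Lemma meanD f g : bmfun f -> bmfun g ->
  mean (fun t => f t + g t) = mean f + mean g.
Proof. by move=> bf bg; apply: RintegralD; auto. Qed.

Lemma meanB f g : bmfun f -> bmfun g ->
  mean (fun t => f t - g t) = mean f - mean g.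
Proof. by move=> bf bg; apply: RintegralB; auto. Qed.

Lemma meanZ c f : bmfun f -> mean (fun t => c * f t) = c * mean f.
Proof. by move=> bf; apply: RintegralZl; auto. Qed.

Lemma mean_cst c : mean (fun=> c) = c * fine (Q setT).
Proof. exact: Rintegral_cst. Qed.

Lemma mean_indic (B : set T) : measurable B -> mean \1_B = fine (Q B).
Proof. by move=> mB; rewrite /mean /Rintegral integral_indic// setIT. Qed.

Lemma mean_sum (I : Type) (r : seq I) (h : I -> T -> R) :
  (forall i, bmfun (h i)) ->
  mean (fun t => \sum_(i <- r) h i t) = \sum_(i <- r) mean (h i).
Proof.
move=> bh; elim: r => [|i r IH].
  under [X in mean X]funext do rewrite big_nil.
  by rewrite big_nil mean_cst mul0r.
under [X in mean X]funext do rewrite big_cons.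
by rewrite big_cons -IH -meanD//; exact: bmfun_sum.
Qed.

End BoundedMeasurable.

(** * The transfer operators of a random walk *)

Section Step.
Context (R : realType) (F : probability (measurableTypeR R) R).
Implicit Types w u f g : R -> R.

Let FF :=
  product_subprobability ((F : subprobability _ R), (F : subprobability _ R)).

Lemma mean_const c : mean F (fun=> c) = c.
Proof.
rewrite mean_cst [X in fine X](_ : _ = 1%E) ?mulr1//.
exact: (probability_setT F).
Qed.

(** The transfer operator of a walk whose increments, of law [F], carry the
weight [w]: indicators constrain the increments, exponentials tilt them. *)
Definition step w f (s : R) : R := mean F (fun z => w z * f (s + z)).

Lemma stepE w f s : step w f s = mean F (fun z => w z * f (s + z)).
Proof. by []. Qed.

Lemma bmfun_shift f (c : R) : bmfun f -> bmfun (fun z : R => f (c + z)).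
Proof.
move=> [mf [M fM]]; split; last by exists M => t.
by apply: (measurableT_comp mf); exact: measurable_funD.
Qed.

Lemma bmfun_shift_prod f : bmfun f -> bmfun (fun p : R * R => f (p.1 + p.2)).
Proof.
move=> [mf [M fM]]; split; last by exists M => t.
by apply: (measurableT_comp mf); exact: measurable_funD.
Qed.

Lemma bmfun_step_integrand w f s : bmfun w -> bmfun f ->
  bmfun (fun z => w z * f (s + z)).
Proof. by move=> bw bf; apply: bmfunM => //; exact: bmfun_shift. Qed.

Lemma bmfun_step w f : bmfun w -> bmfun f -> bmfun (step w f).
Proof.
move=> bw bf; split.
  have bk : bmfun (fun p : R * R => w p.2 * f (p.1 + p.2)).
    apply: bmfunM; last exact: bmfun_shift_prod.
    by case: bw => mw [M wM]; split; [exact: (measurableT_comp mw) | exists M].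
  have := measurable_fubini_F (bmfun_integrable FF bk).
  move=> /= mk; apply: (measurableT_comp (fine_measurable measurableT) mk).
case: bw bf => mw [M wM] [mf [K fK]].
have M0 : 0 <= M by exact: le_trans (wM 0).
have K0 : 0 <= K by exact: le_trans (fK 0).
exists (M * K) => s; rewrite /step.
have bws : bmfun (fun z => w z * f (s + z)).
  by apply: bmfun_step_integrand; split => //; [exists M | exists K].
apply: le_trans (le_normr_Rintegral _ (bmfun_integrable F bws)) _ => //.
rewrite -[leRHS]mean_const.
apply: le_mean; last by move=> z; rewrite normrM ler_pM.
  case: bws => mws [L wL]; split; first exact: measurableT_comp.
  by exists L => t; rewrite normr_id.
exact: bmfun_cst.
Qed.

Lemma step_ge0 w f s : (forall z, 0 <= w z) -> (forall z, 0 <= f z) ->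
  0 <= step w f s.
Proof. by move=> w0 f0; apply: mean_ge0 => z; rewrite mulr_ge0. Qed.

Lemma le_step w u f g s : bmfun w -> bmfun u -> bmfun f -> bmfun g ->
  (forall z, 0 <= w z) -> (forall z, w z <= u z) ->
  (forall z, 0 <= f z) -> (forall z, f z <= g z) ->
  step w f s <= step u g s.
Proof.
move=> bw bu bf bg w0 wu f0 fg.
apply: le_mean; [exact: bmfun_step_integrand|exact: bmfun_step_integrand|].
move=> z; exact: ler_pM.
Qed.

Lemma stepD w f g s : bmfun w -> bmfun f -> bmfun g ->
  step w (fun z => f z + g z) s = step w f s + step w g s.
Proof.
move=> bw bf bg; rewrite /step -meanD; [|exact: bmfun_step_integrand..].
by congr mean; apply/funext => z; rewrite mulrDr.
Qed.

Lemma stepDl w u f s : bmfun w -> bmfun u -> bmfun f ->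
  step (fun z => w z + u z) f s = step w f s + step u f s.
Proof.
move=> bw bf bg; rewrite /step -meanD; [|exact: bmfun_step_integrand..].
by congr mean; apply/funext => z; rewrite mulrDl.
Qed.

Lemma stepZ w f c s : bmfun w -> bmfun f ->
  step w (fun z => c * f z) s = c * step w f s.
Proof.
move=> bw bf; rewrite /step -meanZ; last exact: bmfun_step_integrand.
by congr mean; apply/funext => z; rewrite mulrCA.
Qed.

Lemma step_sum (I : Type) (r : seq I) (h : I -> R -> R) w s :
  bmfun w -> (forall i, bmfun (h i)) ->
  step w (fun z => \sum_(i <- r) h i z) s = \sum_(i <- r) step w (h i) s.
Proof.
move=> bw bh; rewrite /step -mean_sum; last first.
  by move=> i; exact: bmfun_step_integrand.
by congr mean; apply/funext => z; rewrite mulr_sumr.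
Qed.

Lemma step_shift w f c s : step w (fun z => f (z + c)) s = step w f (s + c).
Proof. by rewrite /step; congr mean; apply/funext => z; rewrite addrAC. Qed.

(** Both orders of composition average [f (s + z + z')] against the product
of the two weighted laws; this is Fubini's theorem. *)
Lemma stepC w u f s : bmfun w -> bmfun u -> bmfun f ->
  step u (step w f) s = step w (step u f) s.
Proof.
move=> bw bu bf.
pose k (p : R * R) : \bar R := (u p.1 * (w p.2 * f (s + (p.1 + p.2))))%:E.
have ik : FF.-integrable setT k.
  apply: (@bmfun_integrable _ _ _ FF
    (fun p : R * R => u p.1 * (w p.2 * f (s + (p.1 + p.2))))).
  apply: bmfunM; last apply: bmfunM.
  - by case: bu => mu [M uM]; split; [exact: (measurableT_comp mu) | exists M].
  - by case: bw => mw [M wM]; split; [exact: (measurableT_comp mw) | exists M].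
  - exact: (bmfun_shift_prod (bmfun_shift s bf)).
have E (v t : R -> R) : bmfun v -> bmfun t -> step v (step t f) s =
    fine (\int[F]_x \int[F]_y (v x * (t y * f (s + (x + y))))%:E)%E.
  move=> bv bt; rewrite /step {1}/mean /Rintegral; congr fine.
  apply: eq_integral => x _; rewrite EFinM /mean /Rintegral.
  have bi : bmfun (fun z => t z * f (s + (x + z))).
    under [fun z => _]funext do rewrite addrA.
    exact: bmfun_step_integrand.
  under eq_integral do rewrite -addrA.
  rewrite fineK; last first.
    exact: integrable_fin_num (bmfun_integrable F bi).
  under [RHS]eq_integral do rewrite EFinM.
  rewrite integralZl//; exact: (bmfun_integrable F bi).
rewrite (E u w bu bw) (E w u bw bu).
apply: (congr1 fine); apply: (etrans (Fubini ik)).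
apply: eq_integral => y _; apply: eq_integral => x _.
by rewrite /k /= mulrCA (addrC x).
Qed.

#[local] Opaque step bmfun.

Lemma bmfun_iter_step n w f : bmfun w -> bmfun f -> bmfun (iter n (step w) f).
Proof. by move=> bw bf; elim: n => //= n; exact: bmfun_step. Qed.

Lemma iter_step_ge0 n w f s : (forall z, 0 <= w z) -> (forall z, 0 <= f z) ->
  0 <= iter n (step w) f s.
Proof. by move=> w0 f0; elim: n s => //= n IH s; exact: step_ge0. Qed.

Lemma le_iter_step n w u f g s : bmfun w -> bmfun u -> bmfun f -> bmfun g ->
  (forall z, 0 <= w z) -> (forall z, w z <= u z) ->
  (forall z, 0 <= f z) -> (forall z, f z <= g z) ->
  iter n (step w) f s <= iter n (step u) g s.
Proof.
move=> bw bu bf bg w0 wu f0 fg; elim: n s => [|n IH] s; first exact: fg.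
rewrite !iterS.
apply: (le_step _ bw bu (bmfun_iter_step n bw bf) (bmfun_iter_step n bu bg)
  w0 wu _ IH) => z.
exact: iter_step_ge0.
Qed.

Lemma iter_step_shift n w f c s :
  iter n (step w) (fun z => f (z + c)) s = iter n (step w) f (s + c).
Proof.
elim: n s => [//|n IH] s; rewrite !iterS -step_shift.
congr (step w _ s); apply/funext => z; exact: IH.
Qed.

Lemma iter_stepZ n w f c s : bmfun w -> bmfun f ->
  iter n (step w) (fun z => c * f z) s = c * iter n (step w) f s.
Proof.
move=> bw bf; elim: n s => [//|n IH] s; rewrite !iterS.
rewrite -stepZ//; last exact: bmfun_iter_step.
by congr (step w _ s); apply/funext => z.
Qed.

Lemma iter_step_sum (I : Type) (r : seq I) (h : I -> R -> R) n w s :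
  bmfun w -> (forall i, bmfun (h i)) ->
  iter n (step w) (fun z => \sum_(i <- r) h i z) s =
  \sum_(i <- r) iter n (step w) (h i) s.
Proof.
move=> bw bh; elim: n s => [//|n IH] s; rewrite iterS.
rewrite -step_sum//; last by move=> i; exact: bmfun_iter_step.
by congr (step w _ s); apply/funext => z; rewrite IH.
Qed.

(** If each increment is of type [v] or of type [u], then either all of the
[n] increments are of type [v], or one of them, which by exchangeability may
be taken to be the first, is of type [u]. *)
Lemma iter_step_decomposition n w v u f s :
  bmfun w -> bmfun v -> bmfun u -> bmfun f ->
  (forall z, 0 <= v z) -> (forall z, 0 <= u z) -> (forall z, 0 <= f z) ->
  (forall z, v z <= w z) -> (forall z, w z <= v z + u z) ->
  iter n (step w) f s <=
  iter n (step v) f s + n%:R * step u (iter n.-1 (step w) f) s.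
Proof.
move=> bw bv bu bf v0 u0 f0 vw wvu.
have w0 z : 0 <= w z by exact: le_trans (vw z).
have buf : bmfun (step u f) by exact: bmfun_step.
elim: n s => [|n IH] s /=; first by rewrite mul0r addr0.
have bvn : bmfun (iter n (step v) f) by exact: bmfun_iter_step.
have bun : bmfun (fun z => step u (iter n.-1 (step w) f) z).
  by apply: bmfun_step => //; exact: bmfun_iter_step.
have vn0 z : 0 <= iter n (step v) f z by exact: iter_step_ge0.
have un0 z : 0 <= step u (iter n.-1 (step w) f) z.
  by apply: step_ge0 => // t; exact: iter_step_ge0.
have IH' : step w (iter n (step w) f) s <= step w (iter n (step v) f) s +
    n%:R * step w (step u (iter n.-1 (step w) f)) s.
  have bnu : bmfun (fun z => n%:R * step u (iter n.-1 (step w) f) z).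
    by apply: bmfunM => //; exact: bmfun_cst.
  rewrite -stepZ// -stepD//; apply: le_step => //.
  - exact: bmfun_iter_step.
  - exact: bmfunD.
  - by move=> z; exact: iter_step_ge0.
apply: le_trans IH' _; case: n => [|n] in IH bvn bun vn0 un0 *.
  rewrite mul0r addr0 mul1r /= -stepDl//.
  by apply: le_step => //; exact: bmfunD.
rewrite -[n.+2]addn1 natrD mulrDl mul1r addrA [leRHS]addrAC.
rewrite (stepC s bu bw); last exact: bmfun_iter_step.
rewrite lerD2r.
apply: (@le_trans _ _ (step v (iter n.+1 (step v) f) s +
                       step u (iter n.+1 (step v) f) s)).
  rewrite -stepDl; [|exact: bv|exact: bu|exact: bvn].
  apply: (le_step _ bw (bmfunD bv bu) bvn bvn w0 wvu vn0) => z.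
  exact: lexx.
rewrite lerD2l.
apply: (le_step _ bu bu bvn (bmfun_iter_step n.+1 bw bf) u0 _ vn0) => z.
  exact: lexx.
exact: le_iter_step.
Qed.

End Step.

(** * Laws of constrained random walks *)

Section Independence.
Context d (T : measurableType d) (R : realType).

Lemma mean_mrestr (Q : {finite_measure set T -> \bar R}) (E : set T)
    (mE : measurable E) (f : T -> R) : bmfun f -> (forall t, 0 <= f t) ->
  mean (mrestr Q mE) f = mean Q (fun t => \1_E t * f t).
Proof.
move=> [mf _] f0; rewrite /mean /Rintegral; congr fine.
have mfE : measurable_fun setT (EFin \o f) by exact/measurable_EFinP.
rewrite -(setvU E) setUC ge0_integral_setU//=; last 4 first.
- exact: measurableC.
- by rewrite setUv.
- by move=> t _; rewrite lee_fin.
- by apply/disj_set2P; rewrite setICr.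
rewrite [X in (_ + X)%E](_ : _ = 0%E) ?adde0; last first.
  apply: null_set_integral => //; first exact: measurableC.
    exact: measurable_funTS.
  by rewrite -[LHS]/(Q (~` E `&` E)) setICl measure0.
rewrite setUv.
transitivity (\int[Q]_(t in E) (f t)%:E)%E.
  apply: eq_measure_integral => A mA AE /=.
  by rewrite /mrestr (setIidl AE).
rewrite [LHS]integral_mkcond; apply: eq_integral => t _ /=.
by rewrite /patch indicE; case: (t \in E); rewrite ?mul1r ?mul0r.
Qed.

Section Pushforward.
Context d' (T' : measurableType d').
Variables (Q : {finite_measure set T -> \bar R}) (Y : {mfun T >-> T'}).

(** The pushforward of a finite measure, named so as to carry a structure of
finite measure. *)
Definition finite_law := pushforward Q Y.

Let law0 : finite_law set0 = 0%E.
Proof. exact: measure0. Qed.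

Let law_ge0 A : (0 <= finite_law A)%E.
Proof. exact: measure_ge0. Qed.

Let law_sigma_additive : semi_sigma_additive finite_law.
Proof. exact: measure_semi_sigma_additive. Qed.

HB.instance Definition _ := isMeasure.Build _ _ _ finite_law
  law0 law_ge0 law_sigma_additive.

Let law_fin : fin_num_fun finite_law.
Proof.
move=> A mA; rewrite /finite_law /pushforward; apply: fin_num_measure.
by rewrite -[X in measurable X]setTI; exact: measurable_funP.
Qed.

HB.instance Definition _ := Measure_isFinite.Build _ _ _ finite_law law_fin.

End Pushforward.

(** Rectangles determine a finite measure on the plane, hence the law of
[(Y, Z)] is a product; Tonelli's theorem does the rest. *)
Lemma mean_pair (Q : {finite_measure set T -> \bar R})
    (F : probability (measurableTypeR R) R)
    (Y Z : {mfun T >-> measurableTypeR R}) (k : R * R -> R) :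
  (forall U V : set R, measurable U -> measurable V ->
    Q (Y @^-1` U `&` Z @^-1` V) = (Q (Y @^-1` U) * F V)%E) ->
  bmfun k -> (forall p, 0 <= k p) ->
  mean Q (fun t => k (Y t, Z t)) =
  mean Q (fun t => mean F (fun z => k (Y t, z))).
Proof.
move=> indep bk k0; have [mk _] := bk.
pose YZ t := (Y t, Z t).
have mYZ : measurable_fun setT YZ by exact: measurable_fun_pair.
pose mYZ' := isMeasurableFun.Build _ _ _ _ _ mYZ.
pose YZf : {mfun T >-> (measurableTypeR R * measurableTypeR R)%type} :=
  HB.pack YZ mYZ'.
have mkE : measurable_fun setT (EFin \o k) by exact/measurable_EFinP.
pose nu : {finite_measure set (measurableTypeR R) -> \bar R} := finite_law Q Y.
have kE0 p : (0 <= (EFin \o k) p)%E by rewrite lee_fin.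
have fub := @fubini_tonelli1 _ _ _ _ _ nu F _ mkE kE0.
rewrite /mean /Rintegral; congr fine.
transitivity (\int[finite_law Q YZf]_p (k p)%:E)%E.
  rewrite /finite_law ge0_integral_pushforward//.
  by move=> p _; rewrite lee_fin.
transitivity (\int[(nu \x F)%E]_p (k p)%:E)%E.
  apply: eq_measure_integral => A mA _.
  apply/esym; apply: (@product_measure_unique _ _ _ _ _ nu F); last exact: mA.
  exact: indep.
rewrite fub /nu /finite_law ge0_integral_pushforward//=; last first.
- by move=> y _; apply: integral_ge0 => z _; rewrite lee_fin.
- exact: measurable_fun_fubini_tonelli_F.
apply: eq_integral => t _ /=; rewrite /fubini_F fineK//.
apply: integrable_fin_num => //.
have bkt : bmfun (fun z => k (Y t, z)).
  case: bk => _ [M kM]; split; last by exists M => z.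
  by apply: (measurableT_comp mk); exact: measurable_fun_pair.
exact: (bmfun_integrable F bkt).
Qed.

End Independence.

Section WalkLaw.
Context (R : realType) (F : probability (measurableTypeR R) R).
Context d (T : measurableType d) (P : probability T R).
Context (X : nat -> {RV P >-> R}) (iidX : iid F X).

Let measurable_preim i (B : set R) : measurable B -> measurable (X i @^-1` B).
Proof.
by move=> mB; rewrite -[X in measurable X]setTI; exact: measurable_funP.
Qed.

Lemma measurable_forall_lt (n : nat) (B : nat -> set R) :
  (forall i, measurable (B i)) ->
  measurable [set t | forall i, (i < n)%N -> B i (X i t)].
Proof.
move=> mB.
rewrite (_ : [set t | _] = \bigcap_(i in [set i | (i < n)%N]) (X i @^-1` B i)).
  by apply: fin_bigcap_measurable => // i _; exact: measurable_preim.
by apply/seteqP; split => t /= H i; exact: H.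
Qed.

Lemma iid_prod (n : nat) (B : nat -> set R) : (forall i, measurable (B i)) ->
  fine (P [set t | forall i, (i < n)%N -> B i (X i t)]) =
  \prod_(0 <= i < n) fine (F (B i)).
Proof.
move=> mB; have [indep law] := iidX.
have -> : [set t | forall i, (i < n)%N -> B i (X i t)] =
    \bigcap_(i in [set` [fset i | i in iota 0 n]%fset]) (X i @^-1` B i).
  apply/seteqP; split => t /= H i; last first.
    by move=> ni; apply: H; rewrite /= !inE /= mem_iota.
  by rewrite /= !inE /= mem_iota => /andP[_]; exact: H.
rewrite indep//.
rewrite (perm_big (iota 0 n)); last first.
  apply: uniq_perm; [exact: fset_uniq|exact: iota_uniq|].
  by move=> i; rewrite !inE.
rewrite /index_iota subn0.
rewrite -[RHS]/(fine (\prod_(i <- iota 0 n) fine (F (B i)))%:E).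
rewrite -prodEFin; congr fine; apply: eq_bigr => i _.
rewrite fineK; last exact: (fin_num_measure F _ (mB i)).
exact: (law i _ (mB i)).
Qed.

Lemma measurable_walk m : measurable_fun setT (walk X m).
Proof. by apply: measurable_sum => i; exact: measurable_funP. Qed.

Let walkm m : {mfun T >-> measurableTypeR R} :=
  HB.pack (walk X m) (isMeasurableFun.Build _ _ T (measurableTypeR R) (walk X m)
    (measurable_walk m)).

Let increment m : {mfun T >-> measurableTypeR R} :=
  HB.pack (X m : T -> R) (isMeasurableFun.Build _ _ T (measurableTypeR R)
    (X m : T -> R) (measurable_funPT (X m))).

Variable C : set R.
Hypothesis mC : measurable C.

Let constrained n m (B : nat -> set R) :=
  [set t | forall i, (i < n)%N -> (if (i < m)%N then C else B i) (X i t)].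

Let mconstrained n m B : (forall i, measurable (B i)) ->
  measurable (constrained n m B).
Proof.
move=> mB.
apply: (@measurable_forall_lt n (fun i => if (i < m)%N then C else B i)) => i.
by case: ifP.
Qed.

Let bmfun_walk m (g : R -> R) : bmfun g -> bmfun (fun t => g (walk X m t)).
Proof.
move=> [mg [M gM]]; split; last by exists M.
by apply: (measurableT_comp mg); exact: measurable_walk.
Qed.

(** The first [m] increments are confined to [C], the others up to time [n]
to arbitrary sets; the latter keep the statement strong enough to yield the
independence of [walk X m] and [X m] used in its own induction. *)
Lemma constrained_walk_law n m (B : nat -> set R) (g : R -> R) :
  (m <= n)%N -> (forall i, measurable (B i)) -> bmfun g ->
  (forall z, 0 <= g z) ->
  mean P (fun t => \1_(constrained n m B) t * g (walk X m t)) =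
  iter m (step F \1_C) g 0 * \prod_(m <= i < n) fine (F (B i)).
Proof.
elim: m B g => [|m IH] B g mn mB bg g0.
  rewrite -iid_prod// -[RHS]/(g 0 * fine (P (constrained n 0 B))).
  rewrite -mean_indic; last exact: mconstrained.
  rewrite -meanZ; last by apply: bmfun_indic; exact: mconstrained.
  by congr mean; apply/funext => t; rewrite /walk big_ord0 mulrC.
pose B' V i := if i == m then V else B i.
have mB' V : measurable V -> forall i, measurable (B' V i).
  by move=> mV i; rewrite /B'; case: ifP.
have prodB' V : \prod_(m <= i < n) fine (F (B' V i)) =
    fine (F V) * \prod_(m.+1 <= i < n) fine (F (B i)).
  rewrite big_ltn//; congr (_ * _); first by rewrite /B' eqxx.
  rewrite !big_nat; apply: eq_bigr => i /andP[mi _].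
  by rewrite /B' gtn_eqF.
have mE : measurable (constrained n m (B' setT)).
  by apply: mconstrained; exact: mB'.
have bC : bmfun (\1_C : R -> R) by exact: bmfun_indic.
pose k (p : R * R) := \1_C p.2 * g (p.1 + p.2).
have bk : bmfun k.
  apply: bmfunM; last exact: bmfun_shift_prod.
  case: bC => mC' [M CM]; split; last by exists M.
  exact: (measurableT_comp mC').
have k0 p : 0 <= k p by rewrite mulr_ge0.
have slice U V : measurable U -> measurable V ->
    P (walkm m @^-1` U `&` X m @^-1` V `&` constrained n m (B' setT)) =
    (iter m (step F \1_C) \1_U 0 *
     (fine (F V) * \prod_(m.+1 <= i < n) fine (F (B i))))%:E.
  move=> mU mV.
  have i0 z : 0 <= \1_U z :> R by [].
  rewrite -prodB' -(IH (B' V) \1_U (ltnW mn) (mB' V mV) (bmfun_indic _ mU) i0).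
  have mW : measurable (walkm m @^-1` U `&` X m @^-1` V `&`
                        constrained n m (B' setT)).
    apply: measurableI => //; apply: measurableI; last exact: measurable_preim.
    by rewrite -[X in measurable X]setTI; exact: measurable_walk.
  rewrite -[LHS]fineK ?fin_num_measure// -mean_indic//; congr (_%:E).
  congr mean; apply/funext => t; rewrite !indicE -natrM mulnb; congr (_%:R).
  congr nat_of_bool; apply/idP/andP.
    move=> /set_mem[[Ut Vt] Et]; split; apply/mem_set => // i /Et.
    by rewrite /B'; case: ifP => // _; case: eqP => // ->.
  move=> [/set_mem Et /set_mem Ut]; apply/mem_set; split.
    by split => //; have := Et m mn; rewrite ltnn /B' eqxx.
  by move=> i /Et; rewrite /B'; case: ifP => // _; case: eqP.
transitivity (mean P (fun t => \1_(constrained n m (B' setT)) t *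
                               k (walkm m t, X m t))).
  congr mean; apply/funext => t; rewrite /k/= mulrA /walk big_ord_recr/=.
  congr (_ * _); rewrite !indicE -natrM mulnb; congr (_%:R).
  congr nat_of_bool; apply/idP/andP.
    move=> /set_mem Et; split; apply/mem_set; last first.
      by have := Et m mn; rewrite ltnSn.
    move=> i ni; have := Et i ni; rewrite /B' ltnS.
    by case: ltngtP.
  move=> [/set_mem Et /set_mem Ct]; apply/mem_set => i ni.
  have := Et i ni; rewrite /B' ltnS.
  by case: ltngtP => // ->.
rewrite -(mean_mrestr P mE); last 2 first.
- case: bk => mk [M kM]; split; last by exists M.
  apply: (measurableT_comp mk); apply: measurable_fun_pair => //.
  exact: measurable_walk.
- by move=> t; exact: k0.
rewrite (@mean_pair _ _ _ (mrestr P mE) F (walkm m) (increment m) k)//.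
- rewrite iterSr -[fun t => mean F _]/(fun t => step F \1_C g (walkm m t)).
  have bs : bmfun (step F \1_C g) by exact: bmfun_step.
  have s0 s : 0 <= step F \1_C g s by exact: step_ge0.
  rewrite (mean_mrestr P mE); last 2 first.
  + exact: bmfun_walk.
  + by move=> t; exact: s0.
  rewrite (IH _ _ (ltnW mn) (mB' _ measurableT) bs s0).
  rewrite prodB' [fine (F setT)](_ : _ = 1) ?mul1r//.
  by rewrite probability_setT.
- move=> U V mU mV; rewrite -[LHS]/(P (_ `&` _)) slice//.
  rewrite -[X in (X * _)%E]/(P (walkm m @^-1` U `&` _)).
  rewrite -[walkm m @^-1` U in RHS]setIT -[setT in RHS](preimage_setT (X m)).
  rewrite slice//.
  rewrite -[F V in RHS]fineK ?fin_num_measure// -EFinM; congr (_%:E).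
  rewrite [fine (F setT)](_ : _ = 1) ?mul1r; first by rewrite mulrCA mulrC.
  by rewrite probability_setT.
Qed.

Lemma walk_law n (U : set R) : measurable U ->
  P [set t | (forall i, (i < n)%N -> C (X i t)) /\ U (walk X n t)] =
  (iter n (step F \1_C) \1_U 0)%:E.
Proof.
move=> mU.
have mT (i : nat) : measurable (@setT R) by exact: measurableT.
have mcons := mconstrained n n mT.
have bU : bmfun (\1_U : R -> R) by exact: bmfun_indic.
have U0 z : 0 <= \1_U z :> R by [].
have := constrained_walk_law (leqnn n) mT bU U0.
rewrite big_geq// mulr1 => <-.
set E := [set t | _].
have EE : E = constrained n n (fun=> setT) `&` (walkm n @^-1` U).
  apply/seteqP; split => t /=.
    by move=> [tC tU]; split => // i ni; rewrite ni; exact: tC.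
  by move=> [tC tU]; split => // i ni; have := tC i ni; rewrite ni.
have mE : measurable E.
  rewrite EE; apply: measurableI => //.
  by rewrite -[X in measurable X]setTI; exact: measurable_walk.
rewrite -[LHS]fineK ?fin_num_measure// -mean_indic//; congr (_%:E).
congr mean; apply/funext => t; rewrite EE !indicE -natrM mulnb; congr (_%:R).
by rewrite in_setI.
Qed.

End WalkLaw.

(** * Growth of the scale function *)

Section Scale.
Context (R : realType) (alpha : R) (A : R -> R).
Hypothesis alpha0 : 0 < alpha.
Hypothesis hA : normalized_scale alpha A.

Lemma near_pinfty_ex (Q : R -> Prop) : (\forall x \near +oo, Q x) ->
  exists2 M, 1 <= M & forall x, M <= x -> Q x.
Proof.
move=> [M [_ MQ]]; exists (Num.max 1 (M + 1)); first by rewrite le_max lexx.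
by move=> x; rewrite ge_max => /andP[_ Mx]; apply: MQ; lra.
Qed.

Lemma cvg_ratio_ex (f g : R -> R) (l e : R) :
  f x / g x @[x --> +oo] --> l -> 0 < e ->
  exists2 M, 1 <= M & forall x, M <= x -> `|f x / g x - l| <= e.
Proof.
move=> /cvgrPdist_le fg e0.
have [M M1 H] := near_pinfty_ex (fg e e0).
by exists M => // x /H; rewrite distrC.
Qed.

Lemma scale_le (s t : R) : 0 <= s -> s <= t -> A s <= A t.
Proof.
move=> s0; rewrite le_eqVlt => /predU1P[->//|st].
by apply/ltW/(scale_increasing hA).
Qed.

Lemma scale_ge_half (s : R) : 0 <= s -> 2^-1 <= A s.
Proof. by move=> s0; rewrite -(scale_at0 hA) scale_le. Qed.

Lemma scale_ge1 (s : R) : 1 <= s -> 1 <= A s.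
Proof. by move=> s1; rewrite -(scale_at1 hA) scale_le// ler01. Qed.

Let A0 (s : R) : 0 <= s -> 0 < A s. Proof. exact: (scale_gt0 hA). Qed.

Let log_mvt (k a b : R) : 0 < a -> a < b -> exists2 c, a < c < b &
  (ln (A b) - k * ln b) - (ln (A a) - k * ln a) =
  (derive1 A c / A c - k / c) * (b - a).
Proof.
move=> a0 ab; pose f u := ln (A u) - k * ln u.
have df (x : R) : 0 < x -> is_derive x (1 : R) f (derive1 A x / A x - k / x).
  move=> x0.
  have dA : is_derive x (1 : R) A (derive1 A x).
    rewrite derive1E; apply: derivableP; exact: (scale_derivable hA).
  have dlnA : is_derive x (1 : R) (@ln R \o A) ((A x)^-1 * derive1 A x).
    have := is_derive1_ln (A0 (ltW x0)) => dl.
    exact: is_derive1_comp.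
  have dln := is_derive1_ln x0.
  rewrite mulrC.
  exact: (is_deriveB dlnA (is_deriveZ k dln)).
have dab (x : R) : x \in `]a, b[ ->
    is_derive x (1 : R) f (derive1 A x / A x - k / x).
  by rewrite in_itv /= => /andP[ax _]; apply: df; exact: lt_trans ax.
have cf : {within `[a, b], continuous f}.
  apply: derivable_within_continuous => x; rewrite in_itv /= => /andP[ax _].
  by apply: ex_derive; apply: df; exact: lt_le_trans ax.
have [c] := MVT ab dab cf.
by rewrite in_itv /= => ? ?; exists c.
Qed.

(** The derivative [A'] is squeezed between [beta * A s / s] and
[delta * A s / s], so that [A s / s `^ beta] increases and
[A s / s `^ delta] decreases. *)
Lemma scale_potter (beta delta : R) : beta < alpha -> alpha < delta ->
  exists2 s0, 1 <= s0 & forall s c, s0 <= s -> 1 <= c ->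
    c `^ beta * A s <= A (c * s) <= c `^ delta * A s.
Proof.
move=> ba ad; pose e := Num.min (alpha - beta) (delta - alpha) / alpha.
have e0 : 0 < e by rewrite divr_gt0// lt_min !subr_gt0 ba.
have [s0 s01 H] := cvg_ratio_ex (scale_derive hA) e0.
exists s0 => // s c s0s c1.
have s_gt0 : 0 < s by lra.
have As0 := A0 (ltW s_gt0).
have [->|c_neq1] := eqVneq c 1; first by rewrite !powR1 !mul1r lexx.
have {c_neq1} c1' : 1 < c by rewrite lt_neqAle eq_sym c_neq1.
have c0 : 0 < c by lra.
have scs : s < c * s by rewrite ltr_pMl.
have cs0 : 0 < c * s by exact: mulr_gt0.
have Acs0 := A0 (ltW cs0).
have lnD k : (ln (A (c * s)) - k * ln (c * s)) - (ln (A s) - k * ln s) =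
    ln (A (c * s)) - ln (c `^ k * A s).
  by rewrite !lnM ?posrE ?powR_gt0// ln_powR; ring.
have bound u : s < u -> beta / u <= derive1 A u / A u <= delta / u.
  move=> su; have u0 : 0 < u by lra.
  have Au0 := A0 (ltW u0).
  have := H u (ltW (le_lt_trans s0s su)).
  rewrite -(ler_pM2l alpha0).
  have -> : alpha * `|derive1 A u / (alpha * A u / u) - 1| =
      `|derive1 A u / A u * u - alpha|.
    rewrite -{1}(gtr0_norm alpha0) -normrM; congr `| _ |.
    by field; rewrite !gt_eqF.
  rewrite /e mulrCA divff ?gt_eqF// mulr1 ler_distl => /andP[l1 l2].
  rewrite ler_pdivrMr// ler_pdivlMr//; apply/andP; split.
    apply: le_trans l1.
    suff : Num.min (alpha - beta) (delta - alpha) <= alpha - beta by lra.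
    by rewrite ge_min lexx.
  apply: le_trans l2 _.
  suff : Num.min (alpha - beta) (delta - alpha) <= delta - alpha by lra.
  by rewrite ge_min lexx orbT.
apply/andP; split.
  have [u /andP[su _]] := log_mvt beta s_gt0 scs; rewrite lnD => E.
  rewrite -ler_ln ?posrE ?mulr_gt0 ?powR_gt0// -subr_ge0 E mulr_ge0//; last lra.
  by rewrite subr_ge0; have /andP[] := bound u su.
have [u /andP[su _]] := log_mvt delta s_gt0 scs; rewrite lnD => E.
rewrite -ler_ln ?posrE ?mulr_gt0 ?powR_gt0// -subr_le0 E.
rewrite mulr_le0_ge0//; last lra.
by rewrite subr_le0; have /andP[] := bound u su.
Qed.

(** The growth bound holds for large [s] only; on a bounded range [A] lies
between positive constants. *)
Lemma scale_doubling (K : R) : 1 <= K ->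
  exists2 C, 1 <= C & forall s, 0 <= s -> A (K * s) <= C * A s.
Proof.
move=> K1; have K0 : 0 <= K by lra.
have [s0 s01 H] := @scale_potter 0 (alpha + 1) alpha0 ltac:(lra).
exists (Num.max (K `^ (alpha + 1)) (2 * A (K * s0))).
  rewrite le_max; apply/orP; right.
  have := @scale_ge1 (K * s0).
  rewrite (_ : 1 <= K * s0); last by rewrite mulr_ege1.
  by move=> /(_ isT); lra.
move=> s s_ge0; have As := scale_ge_half s_ge0.
have [s0s|ss0] := leP s0 s.
  have /andP[_ /le_trans->//] := H s K s0s K1.
  by rewrite ler_wpM2r ?le_max ?lexx//; lra.
apply: (@le_trans _ _ (A (K * s0))).
  by apply: scale_le; [exact: mulr_ge0 | rewrite ler_wpM2l// ltW].
apply: (@le_trans _ _ ((2 * A (K * s0)) * A s)).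
  have : 0 < A (K * s0) by apply: A0; apply: mulr_ge0 => //; lra.
  by nra.
by rewrite ler_wpM2r ?le_max ?lexx ?orbT//; lra.
Qed.

Lemma scale_inv_spec n : (1 <= n)%N ->
  1 <= scale_inv A n%:R /\ A (scale_inv A n%:R) = n%:R.
Proof.
move=> n1.
have a2 : alpha / 2 < alpha by rewrite ltr_pdivrMr// ltr_pMr// ltr1n.
have a1 : alpha < alpha + 1 by lra.
have [s0 s01 H] := scale_potter a2 a1.
pose c := Num.max 1 (n%:R `^ (2 / alpha)) : R.
have c1 : 1 <= c by rewrite le_max lexx.
have cs1 : 1 <= c * s0 by rewrite mulr_ege1.
have nA : n%:R <= A (c * s0).
  have /andP[+ _] := H s0 c (lexx _) c1; apply: le_trans.
  have As0 := scale_ge1 s01.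
  apply: (@le_trans _ _ (c `^ (alpha / 2))); last by rewrite ler_peMr ?powR_ge0.
  have -> : n%:R = (n%:R `^ (2 / alpha)) `^ (alpha / 2) :> R.
    rewrite -powRrM (_ : 2 / alpha * (alpha / 2) = 1) ?powRr1//.
    by field; rewrite gt_eqF.
  apply: ge0_ler_powR; rewrite ?nnegrE ?powR_ge0//; first lra.
    lra.
  by rewrite le_max lexx orbT.
have cA : {within `[1, c * s0], continuous A}.
  apply: derivable_within_continuous => x; rewrite in_itv /= => /andP[x1 _].
  by apply: (scale_derivable hA); lra.
have n1R : (1 : R) <= n%:R by rewrite ler1n.
have [|s] := IVT cs1 cA (v := n%:R).
  by rewrite ge_min le_max (scale_at1 hA) n1R nA orbT.
rewrite in_itv /= => /andP[s1 _] An.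
suff -> : scale_inv A n%:R = s by [].
rewrite -An /scale_inv; apply: pinvKV; last first.
  by apply/mem_set; rewrite /= in_itv/= andbT; lra.
move=> x y /set_mem/= + /set_mem/=; rewrite !in_itv/= !andbT => x0 y0 Axy.
case: (ltgtP x y) => // lt.
  by have := scale_increasing hA x0 lt; rewrite Axy ltxx.
by have := scale_increasing hA y0 lt; rewrite Axy ltxx.
Qed.

Lemma scale_lt_le (s t : R) : 0 <= t -> A s <= A t -> s <= t.
Proof.
move=> t0 Ast; rewrite leNgt; apply/negP => /(scale_increasing hA t0).
by rewrite ltNge Ast.
Qed.

Lemma scale_inv_succ : exists2 C, 1 <= C & forall n, (1 <= n)%N ->
  scale_inv A n.+1%:R <= C * scale_inv A n%:R.
Proof.
have a2 : alpha / 2 < alpha by rewrite ltr_pdivrMr// ltr_pMr// ltr1n.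
have a1 : alpha < alpha + 1 by lra.
have [s0 s01 H] := scale_potter a2 a1.
pose K : R := 2 `^ (2 / alpha).
have K1 : 1 <= K.
  rewrite -(powRr0 2) /K ler_powR//; first by lra.
  by rewrite divr_ge0//; lra.
exists (K * s0); first exact: mulr_ege1.
move=> n n1; have [a_ge1 An] := scale_inv_spec n1.
have [b1 Bn] := scale_inv_spec (ltn0Sn n).
set a := scale_inv A n%:R in a_ge1 An *; set b := scale_inv A _ in b1 Bn *.
have s0a : s0 <= s0 * a by rewrite ler_peMr//; lra.
have K0 : 0 <= K by lra.
have sa0 : 0 <= s0 * a by apply: mulr_ge0; lra.
apply: scale_lt_le; first by rewrite -mulrA mulr_ge0.
have := H (s0 * a) K s0a K1.
rewrite /K -powRrM (_ : 2 / alpha * (alpha / 2) = 1); last first.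
  by field; rewrite gt_eqF.
rewrite powRr1// -/K => /andP[+ _]; rewrite mulrA; apply: le_trans.
rewrite Bn; have : A a <= A (s0 * a).
  by apply: scale_le; [lra|rewrite ler_peMl//; lra].
rewrite An -addn1 natrD; have : (1 : R) <= n%:R by rewrite ler1n.
lra.
Qed.

End Scale.

(** * Tails of the increments *)

Section Tails.
Context (R : realType) (alpha : R) (A : R -> R).
Hypothesis alpha0 : 0 < alpha.
Hypothesis hA : normalized_scale alpha A.
Variable F : probability (measurableTypeR R) R.

Let A0 (s : R) : 0 <= s -> 0 < A s. Proof. exact: (scale_gt0 hA). Qed.

Lemma fine_prob_le1 (B : set R) : measurable B -> fine (F B) <= 1.
Proof.
move=> mB; rewrite -lee_fin fineK; first exact: probability_le1.
exact: (fin_num_measure F _ mB).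
Qed.

Lemma fine_prob_ge0 (B : set R) : 0 <= fine (F B).
Proof. exact: fine_ge0. Qed.

Lemma tail_le (t : R -> R) (c l : R) : 0 < c -> (forall x, t x <= 1) ->
  t x / (c / A x) @[x --> +oo] --> l ->
  exists2 C, 1 <= C & forall x, 0 <= x -> t x <= C / A x.
Proof.
move=> c0 t1 /(@cvg_ratio_ex _ t _ l 1) /(_ ltr01)[M M1 H].
have AM := scale_ge1 hA M1.
exists (A M + (`|l| + 1) * c).
  by have : 0 <= (`|l| + 1) * c by [rewrite mulr_ge0// ?addr_ge0// ltW]; lra.
move=> x x0; have Ax := A0 x0; have lc : 0 <= (`|l| + 1) * c.
  by rewrite mulr_ge0// ?addr_ge0// ltW.
rewrite ler_pdivlMr//; have [Mx|xM] := leP M x.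
  have := H x Mx.
  rewrite (_ : t x / (c / A x) = t x * A x / c); last first.
    by field; rewrite !gt_eqF.
  rewrite ler_distl => /andP[_]; rewrite ler_pdivrMr// => /le_trans; apply.
  apply: (@le_trans _ _ ((`|l| + 1) * c)); last by lra.
  by rewrite ler_wpM2r ?(ltW c0)// lerD2r ler_norm.
have : A x <= A M by apply: (scale_le hA) => //; exact: ltW.
have [t0|t0] := leP (t x) 0.
  by move=> _; have : t x * A x <= 0 by [rewrite mulr_le0_ge0// ltW]; lra.
by have : t x * A x <= A x by [rewrite ler_piMl// ltW]; lra.
Qed.

Variable p : R.
Hypothesis hp : 0 < p.
Hypothesis hright :
  asymp_equiv (fun x => fine (F `]x, +oo[%classic)) (fun x => p / A x).

Lemma right_tail_le : exists2 C, 1 <= C &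
  forall x, 0 <= x -> fine (F `]x, +oo[%classic) <= C / A x.
Proof. by apply: (tail_le hp _ hright) => x; exact: fine_prob_le1. Qed.

(** The mass beyond [r] exceeds that beyond [2 * r] by a factor close to
[2 `^ alpha > 1], hence the dyadic window carries a fixed part of it. *)
Lemma right_window_ge : exists c r0, [/\ 0 < c, 1 <= r0 &
  forall r, r0 <= r -> c / A r <= fine (F `]r, (2 * r)]%classic)].
Proof.
have a2 : alpha / 2 < alpha by rewrite ltr_pdivrMr// ltr_pMr// ltr1n.
have a1 : alpha < alpha + 1 by rewrite ltrDl.
have [s0 s01 HA] := scale_potter alpha0 hA a2 a1.
pose k : R := 2 `^ (alpha / 2).
have k1 : 1 < k.
  rewrite /k -[ltLHS](_ : 1 `^ (alpha / 2) = 1); last by rewrite powR1.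
  by apply: gt0_ltr_powR; rewrite ?nnegrE ?divr_gt0// ltr1n.
pose e := (k - 1) / (2 * (k + 1)).
have e0 : 0 < e by apply: divr_gt0; lra.
have [M M1 H] := cvg_ratio_ex hright e0.
exists (p * (k - 1) / (2 * k)), (Num.max s0 M); split.
- by apply: divr_gt0; [apply: mulr_gt0; [exact: hp|lra]|lra].
- by rewrite le_max s01.
move=> r; rewrite ge_max => /andP[s0r Mr].
have r0 : 0 < r by lra.
have Ar := A0 (ltW r0).
have A2r : 0 < A (2 * r) by apply: A0; lra.
have /andP[kA _] := HA r 2 s0r (ltW (ltr1n _ 2)).
rewrite -/k in kA.
have -> : fine (F `]r, (2 * r)]%classic) =
    fine (F `]r, +oo[%classic) - fine (F `]2 * r, +oo[%classic).
  have mI (i : interval R) : F [set` i] \is a fin_num.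
    exact: (fin_num_measure F _ (measurable_itv i)).
  have r2 : r <= 2 * r by lra.
  rewrite (@itv_bndbnd_setU _ _ (BRight r) (BRight (2 * r)) +oo%O) ?bnd_simp//.
  rewrite measureU//; last first.
    apply/seteqP; split => // x []/=; rewrite !in_itv/= => /andP[_ x1].
    by rewrite andbT ltNge x1.
  by rewrite fineD ?mI// addrK.
have := H r Mr; have := H (2 * r) ltac:(lra).
rewrite (_ : fine (F `]r, +oo[%classic) / (p / A r) =
             fine (F `]r, +oo[%classic) * A r / p); last first.
  by field; rewrite !gt_eqF.
rewrite (_ : fine (F `]2 * r, +oo[%classic) / (p / A (2 * r)) =
             fine (F `]2 * r, +oo[%classic) * A (2 * r) / p); last first.
  by field; rewrite !gt_eqF.
set u := fine (F `]r, +oo[%classic); set v := fine (F `]2 * r, +oo[%classic).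
rewrite !ler_distl => /andP[_ vle] /andP[ule _].
rewrite ler_pdivrMr// in vle; rewrite ler_pdivlMr// in ule.
have v0 : 0 <= v by exact: fine_prob_ge0.
rewrite ler_pdivrMr// mulrBl.
have vA : v * A r <= (1 + e) * p / k.
  rewrite ler_pdivlMr; last lra.
  by apply: le_trans vle; rewrite -mulrA ler_wpM2l// mulrC.
apply: (@le_trans _ _ ((1 - e) * p - (1 + e) * p / k)); last lra.
rewrite le_eqVlt; apply/orP; left; apply/eqP; rewrite /e.
by field; rewrite !gt_eqF//; lra.
Qed.

End Tails.

(** * Truncated moments of the increments *)

Lemma bmfun_indicM d (T : measurableType d) (R : realType) (B : set T)
    (f : T -> R) (M : R) : measurable B -> measurable_fun setT f ->
  (forall t, B t -> `|f t| <= M) -> bmfun (fun t => \1_B t * f t).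
Proof.
move=> mB mf fM; split.
  by apply: measurable_funM => //; exact: measurable_indic.
exists `|M| => t; rewrite indicE; case: (boolP (t \in B)) => [/set_mem Bt|_].
  by rewrite mul1r (le_trans (fM t Bt))// ler_norm.
by rewrite mul0r normr0.
Qed.

Lemma ltr_powR (R : realType) (c a b : R) : 1 < c -> a < b -> c `^ a < c `^ b.
Proof.
move=> c1 ab; have c0 : 0 < c by lra.
by rewrite -ltr_ln ?posrE ?powR_gt0// !ln_powR ltr_pM2r// ln_gt0.
Qed.

Lemma le_indic (T : Type) (R : realType) (B C : set T) (t : T) : B `<=` C ->
  \1_B t <= \1_C t :> R.
Proof.
move=> BC; rewrite !indicE ler_nat; case: (boolP (t \in B)) => // /set_mem Bt.
by rewrite mem_set//; exact: BC.
Qed.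

Section Moments.
Context (R : realType) (alpha : R) (A : R -> R).
Hypothesis alpha0 : 0 < alpha.
Hypothesis hA : normalized_scale alpha A.
Variable F : probability (measurableTypeR R) R.

Let A0 (s : R) : 0 <= s -> 0 < A s. Proof. exact: (scale_gt0 hA). Qed.

(** A quantity which increases by at most [D * y ^+ r / A y] when [y] is
doubled is dominated by the last such increment, provided [A] grows by less
than [2 ^+ r] under doubling: the increments then form a geometric sum. *)
Lemma dyadic_growth (r : nat) (G : R -> R) (kappa s0 D : R) : 1 <= s0 ->
  0 < kappa -> kappa < 2 ^+ r -> 0 <= D ->
  (forall y, s0 <= y -> A (2 * y) <= kappa * A y) ->
  (forall y, s0 <= y -> G (2 * y) <= G y + D * y ^+ r / A y) ->
  (forall y z, s0 <= y -> y <= z -> G y <= G z) ->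
  exists2 C, 0 <= C & forall y, s0 <= y -> G y <= C * y ^+ r / A y.
Proof.
move=> s01 k0 kr D0 HA HG Gmono.
have s0_gt0 : 0 < s0 by lra.
pose C := Num.max (D * kappa / (2 ^+ r - kappa)) (`|G (2 * s0)| * A (2 * s0)).
have C0 : 0 <= C.
  by rewrite le_max divr_ge0// ?subr_ge0 ?(ltW kr)// mulr_ge0// ltW.
have CD : (C + D) * kappa <= C * 2 ^+ r.
  have : D * kappa / (2 ^+ r - kappa) <= C by rewrite le_max lexx.
  by rewrite ler_pdivrMr ?subr_gt0//; lra.
exists C => //.
suff H : forall k y, s0 <= y -> y <= 2 ^+ k * s0 ->
    G y <= C * y ^+ r / A y.
  move=> y s0y; apply: (H (Num.bound y)) => //.
  apply: (@le_trans _ _ (Num.bound y)%:R).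
    by apply: ltW; apply: archi_boundP; lra.
  apply: (@le_trans _ _ (2 ^+ Num.bound y)).
    by rewrite -natrX ler_nat ltnW// ltn_expl.
  by rewrite ler_peMr// exprn_ge0.
have base y : s0 <= y -> y <= 2 * s0 -> G y <= C * y ^+ r / A y.
  move=> s0y y2; have Ay : 0 < A y by apply: A0; lra.
  rewrite ler_pdivlMr//.
  have G1 := Gmono y _ s0y y2.
  have A1 : A y <= A (2 * s0) by apply: (scale_le hA); lra.
  apply: (@le_trans _ _ (`|G (2 * s0)| * A (2 * s0))).
    apply: (@le_trans _ _ (`|G (2 * s0)| * A y)).
      by rewrite ler_wpM2r// ?(ltW Ay)// (le_trans G1)// ler_norm.
    by rewrite ler_wpM2l.
  apply: (@le_trans _ _ C); first by rewrite le_max lexx orbT.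
  by rewrite ler_peMr// exprn_ege1//; lra.
elim=> [|k IH] y s0y yk; first by apply: base => //; lra.
have [y2|y2] := leP y (2 * s0); first exact: base.
have [x yx] : exists x, y = 2 * x by exists (y / 2); field.
have s0x : s0 <= x by lra.
have xk : x <= 2 ^+ k * s0 by move: yk; rewrite exprS yx -mulrA; lra.
have Gx := IH x s0x xk.
have Ax : 0 < A x by apply: A0; lra.
have A2x : 0 < A (2 * x) by apply: A0; lra.
have xr0 : 0 <= x ^+ r by apply: exprn_ge0; lra.
rewrite yx; apply: (le_trans (HG x s0x)).
apply: (@le_trans _ _ ((C + D) * x ^+ r / A x)); first by rewrite !mulrDl; lra.
rewrite exprMn ler_pdivrMr// [leRHS]mulrAC ler_pdivlMr//.
apply: (@le_trans _ _ ((C + D) * x ^+ r * (kappa * A x))).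
  by apply: ler_wpM2l; [rewrite mulr_ge0 ?addr_ge0|exact: HA].
have := ler_wpM2r (mulr_ge0 xr0 (ltW Ax)) CD.
by rewrite !mulrA; lra.
Qed.


Variables CR CL : R.
Hypothesis CR1 : 1 <= CR.
Hypothesis CL1 : 1 <= CL.
Hypothesis right_tail :
  forall x, 0 <= x -> fine (F `]x, +oo[%classic) <= CR / A x.
Hypothesis left_tail :
  forall x, 0 <= x -> fine (F `]-oo, - x]%classic) <= CL / A x.

Lemma positive_part_truncated_mean : alpha < 1 -> exists C y0,
  [/\ 0 <= C, 1 <= y0 & forall y, y0 <= y ->
    mean F (fun z => \1_(`]0, y]) z * z) <= C * y / A y].
Proof.
move=> alpha1.
pose delta := (alpha + 1) / 2.
have ad : alpha < delta by have := alpha0; rewrite /delta; lra.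
have d1 : delta < 1 by rewrite /delta; lra.
have [s0 s01 HA] := scale_potter alpha0 hA alpha0 ad.
have CR0 : 0 <= 2 * CR by have := CR1; lra.
have bI y : bmfun (fun z : R => \1_(`]0, y]) z * z).
  apply: (@bmfun_indicM _ _ _ _ id y) => // z /=.
  by rewrite in_itv /= => /andP[z0 zy]; rewrite gtr0_norm.
have [|||||C C0 H] := @dyadic_growth 1
    (fun y => mean F (fun z => \1_(`]0, y]) z * z)) (2 `^ delta) s0 (2 * CR) s01
    _ _ CR0.
- exact: powR_gt0.
- by rewrite expr1 -[ltRHS](powRr1 (ltW (ltr0Sn _ 1))) ltr_powR// ltr1n.
- by move=> y s0y; have /andP[_] := HA y 2 s0y (ltW (ltr1n _ 2)).
- move=> y s0y.
  have y0 : 0 <= y by lra.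
  have mtail : measurable (`]y, +oo[%classic : set R) by exact: measurable_itv.
  have btail : bmfun (\1_(`]y, +oo[%classic) : R -> R) by exact: bmfun_indic.
  apply: (@le_trans _ _ (mean F (fun z => \1_(`]0, y]) z * z) +
                         2 * y * mean F \1_(`]y, +oo[%classic))).
    rewrite -meanZ// -meanD; [|exact: bI|]; last first.
      exact: (bmfunM (bmfun_cst _ (2 * y)) btail).
    apply: le_mean; [exact: bI| |move=> z].
      exact: (bmfunD (bI y) (bmfunM (bmfun_cst _ (2 * y)) btail)).
    rewrite !indicE !mem_setE !in_itv/= andbT.
    case: (ltP 0 z) => z0 /=; last by case: (ltP y z) => ? /=; lra.
    by case: (leP z y) => zy; case: (leP z (2 * y)) => z2 /=; lra.
  rewrite lerD2l mean_indic// expr1.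
  have := ler_wpM2l y0 (right_tail y0); have := A0 y0; rewrite !mulrA => ? ?.
  by lra.
- move=> y z s0y yz; apply: le_mean; [exact: bI|exact: bI|move=> t].
  case: (leP 0 t) => t0.
    by rewrite ler_wpM2r// le_indic// => u /=; rewrite !in_itv/=; lra.
  by rewrite !indicE !mem_setE !in_itv/= (lt_gtF t0) !mul0r.
by exists C, s0; split => // y /H; rewrite expr1.
Qed.

Lemma truncated_second_moment : alpha < 2 -> exists C y0,
  [/\ 0 <= C, 1 <= y0 & forall y, y0 <= y ->
    mean F (fun z => \1_(`[- y, y]) z * z ^+ 2) <= C * y ^+ 2 / A y].
Proof.
move=> alpha2.
pose delta := (alpha + 2) / 2.
have ad : alpha < delta by rewrite /delta; lra.
have d2 : delta < 2 by rewrite /delta; lra.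
have [s0 s01 HA] := scale_potter alpha0 hA alpha0 ad.
have C0 : 0 <= 4 * (CR + CL) by have := CR1; have := CL1; lra.
have sq0 (z : R) : 0 <= z ^+ 2 by exact: sqr_ge0.
have bI y : bmfun (fun z : R => \1_(`[- y, y]) z * z ^+ 2).
  apply: (@bmfun_indicM _ _ _ _ _ (y ^+ 2)) => // z /=.
  rewrite in_itv /= => /andP[z0 zy]; rewrite ger0_norm//; nra.
have [|||||C C0' H] := @dyadic_growth 2
    (fun y => mean F (fun z => \1_(`[- y, y]) z * z ^+ 2)) (2 `^ delta) s0
    (4 * (CR + CL)) s01 _ _ C0.
- exact: powR_gt0.
- by rewrite -powR_mulrn// ltr_powR// ltr1n.
- by move=> y s0y; have /andP[_] := HA y 2 s0y (ltW (ltr1n _ 2)).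
- move=> y s0y.
  have y0 : 0 <= y by lra.
  have bR : bmfun (\1_(`]y, +oo[%classic) : R -> R).
    by apply: bmfun_indic; exact: measurable_itv.
  have bL : bmfun (\1_(`]-oo, - y]%classic) : R -> R).
    by apply: bmfun_indic; exact: measurable_itv.
  have y2 := sq0 y.
  apply: (@le_trans _ _ (mean F (fun z => \1_(`[- y, y]) z * z ^+ 2) +
      4 * y ^+ 2 * (mean F \1_(`]y, +oo[%classic) +
                    mean F \1_(`]-oo, - y]%classic)))).
    have bt : bmfun (fun z => 4 * y ^+ 2 *
        (\1_(`]y, +oo[%classic) z + \1_(`]-oo, - y]%classic) z)).
      exact: (bmfunM (bmfun_cst _ (4 * y ^+ 2)) (bmfunD bR bL)).
    rewrite -meanD// -meanZ; last exact: bmfunD.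
    rewrite -meanD; [|exact: bI|exact: bt].
    apply: le_mean; [exact: bI|exact: (bmfunD (bI y) bt)|move=> z].
    rewrite !indicE !mem_setE !in_itv/= andbT.
    have z2 := sq0 z; have y4 : 0 <= 4 * y ^+ 2 by rewrite mulr_ge0.
    case: (boolP (- (2 * y) <= z <= 2 * y)) => [/andP[l1 l2]|_]; last first.
      rewrite mul0r; apply: addr_ge0; first exact: mulr_ge0.
      by apply: mulr_ge0 => //; exact: addr_ge0.
    have z4 : z ^+ 2 <= 4 * y ^+ 2.
      have k1 : 0 <= 2 * y - z by lra.
      have k2 : 0 <= 2 * y + z by lra.
      by have := mulr_ge0 k1 k2; lra.
    case: (boolP (- y <= z <= y)) => [_|].
      by rewrite mul1r lerDl; apply: mulr_ge0 => //; exact: addr_ge0.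
    rewrite negb_and -!ltNge mul1r mul0r add0r => /orP[zy|yz].
      by rewrite (ltW zy) (le_trans z4)// ler_peMr// lerDr.
    by rewrite yz (le_trans z4)// ler_peMr// lerDl.
  rewrite lerD2l !mean_indic//.
  have := ler_wpM2l y2 (right_tail y0); have := ler_wpM2l y2 (left_tail y0).
  by rewrite !mulrA => ? ?; lra.
- move=> y z s0y yz; apply: le_mean; [exact: bI|exact: bI|move=> t].
  by rewrite ler_wpM2r// le_indic// => u /=; rewrite !in_itv/=; lra.
by exists C, s0; split.
Qed.

Section LeftTailMean.
Hypothesis integrable_id : F.-integrable setT (EFin \o (fun z : R => z)).

Let tail_fun (y z : R) : R := \1_(`]-oo, - y[) z * - z.

Let tail_fun_le y z : `|tail_fun y z| <= `|z|.
Proof.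
rewrite /tail_fun indicE mem_setE in_itv/=.
by case: (z < - y)%R; rewrite ?mul1r ?normrN// mul0r normr0.
Qed.

Let measurable_tail_fun y : measurable_fun setT (tail_fun y).
Proof.
apply: measurable_funM; last exact: measurable_funN.
by apply: measurable_indic; exact: measurable_itv.
Qed.

Let integrable_tail_fun y : F.-integrable setT (EFin \o tail_fun y).
Proof.
apply: (le_integrable measurableT) integrable_id.
  by apply/measurable_EFinP; exact: measurable_tail_fun.
by move=> z _ /=; rewrite lee_fin; exact: tail_fun_le.
Qed.

Let tail_fun_double y : 0 <= y ->
  mean F (tail_fun y) <= 2 * CL * y / A y + mean F (tail_fun (2 * y)).
Proof.
move=> y0.
have bL : bmfun (fun z : R => 2 * y * \1_(`]-oo, - y]%classic) z).
  apply: (bmfunM (bmfun_cst _ (2 * y))).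
  by apply: bmfun_indic; exact: measurable_itv.
apply: (@le_trans _ _ (mean F (fun z => 2 * y * \1_(`]-oo, - y]%classic) z)
                       + mean F (tail_fun (2 * y)))).
  rewrite -[leRHS]RintegralD//; last exact: (bmfun_integrable F bL).
  apply: le_Rintegral => //.
    exact: (integrableD measurableT (bmfun_integrable F bL)
             (integrable_tail_fun (2 * y))).
  move=> z _; rewrite /tail_fun !indicE !mem_setE !in_itv/=.
  case: (leP z (- y)) => zy; case: (ltP z (- y)) => zy';
  case: (ltP z (- (2 * y))) => z2 /=; lra.
rewrite lerD2r meanZ; last by apply: bmfun_indic; exact: measurable_itv.
rewrite mean_indic; last exact: measurable_itv.
have := ler_wpM2l y0 (left_tail y0).
by rewrite mulrA => ?; lra.
Qed.

Let tail_fun_cvg0 y : 1 <= y ->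
  mean F (tail_fun (2 ^+ n * y)) @[n --> \oo] --> 0.
Proof.
move=> y1.
have mf n : measurable_fun setT (EFin \o tail_fun (2 ^+ n * y)).
  by apply/measurable_EFinP; exact: measurable_tail_fun.
have m0 : measurable_fun setT (cst 0 : R -> \bar R) by exact: measurable_cst.
have cv : {ae F, forall z : R, setT z ->
    (EFin \o tail_fun (2 ^+ n * y)) z @[n --> \oo] --> (cst 0 : R -> \bar R) z}.
  apply: aeW => z _; apply: cvg_near_cst; near=> n.
  rewrite /tail_fun/= indicE mem_setE in_itv/= ltNge.
  suff -> : - (2 ^+ n * y) <= z by rewrite mul0r.
  have zn : `|z| <= n%:R by near: n; exact: nbhs_infty_ger.
  have n2 : n%:R <= 2 ^+ n :> R by rewrite -natrX ler_nat ltnW// ltn_expl.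
  have ny : 2 ^+ n <= 2 ^+ n * y by rewrite ler_peMr// exprn_ge0.
  have := ler_norm (- z); rewrite normrN; lra.
have ig : F.-integrable setT (abse \o (EFin \o (fun z : R => z))).
  exact: integrable_abse.
have fg : {ae F, forall (z : R) n, setT z ->
    (`|(EFin \o tail_fun (2 ^+ n * y)) z| <=
     (abse \o (EFin \o (fun z : R => z))) z)%E}.
  by apply: aeW => z n _; rewrite lee_fin; exact: tail_fun_le.
have [_ _] := @dominated_convergence _ (measurableTypeR R) R F setT measurableT
  (fun n => EFin \o tail_fun (2 ^+ n * y)) (cst 0%E) _ mf m0 cv ig fg.
rewrite integral0 => /fine_cvgP[_].
exact.
Unshelve. all: by end_near.
Qed.

(** From [y] to [2 * y] the ratio [y / A y] decreases by at least a fixed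
factor, because [alpha > 1]. Hence the dyadic contributions
[2 * y * F (`]-oo, - y])] form a geometric series dominated by its first
term, and the remainder tends to [0] since the mean is finite. *)
Lemma left_tail_mean : 1 < alpha -> exists C y0,
  [/\ 0 <= C, 1 <= y0 & forall y, y0 <= y ->
    mean F (fun z => \1_(`]-oo, - y[) z * - z) <= C * y / A y].
Proof.
move=> alpha1.
pose beta := (alpha + 1) / 2.
have ba : beta < alpha by rewrite /beta; lra.
have b1 : 1 < beta by rewrite /beta; lra.
have a1 : alpha < alpha + 1 by rewrite ltrDl.
have [s0 s01 HA] := scale_potter alpha0 hA ba a1.
pose k : R := 2 `^ beta.
have k2 : 2 < k.
  by rewrite /k -[ltLHS](powRr1 (ltW (ltr0Sn _ 1))) ltr_powR// ltr1n.
pose C := 2 * CL * k / (k - 2).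
have CL0 : 0 <= 2 * CL by have := CL1; lra.
have C0 : 0 <= C by apply: divr_ge0; [apply: mulr_ge0 => //|]; lra.
exists C, s0; split => //.
suff H : forall n y, s0 <= y ->
    mean F (tail_fun y) <= C * y / A y + mean F (tail_fun (2 ^+ n * y)).
  move=> y s0y; apply/ler_addgt0Pr => e e0.
  have y1 : 1 <= y by lra.
  have /cvgr0Pnorm_lt/(_ e e0)[n _ /(_ n (leqnn n)) He] := tail_fun_cvg0 y1.
  apply: le_trans (H n y s0y) _; rewrite lerD2l ltW//.
  exact: le_lt_trans (ler_norm _) He.
elim=> [|n IH] y s0y.
  rewrite expr0 mul1r lerDr mulr_ge0 ?invr_ge0//.
    by rewrite mulr_ge0//; lra.
  by apply/ltW/A0; lra.
have y0 : 0 <= y by lra.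
apply: le_trans (tail_fun_double y0) _.
have s2y : s0 <= 2 * y by lra.
have := IH (2 * y) s2y; rewrite mulrA -exprSr => IH2.
apply: (@le_trans _ _ (2 * CL * y / A y + C * (2 * y) / A (2 * y) +
    mean F (tail_fun (2 ^+ n.+1 * y)))); first by rewrite -addrA lerD2l.
rewrite lerD2r.
have Ay := A0 y0; have A2y : 0 < A (2 * y) by apply: A0; lra.
have /andP[kA _] := HA y 2 s0y (ltW (ltr1n _ 2)).
rewrite -/k in kA.
have yk : y / A (2 * y) <= y / (k * A y).
  by rewrite ler_wpM2l// lef_pV2 ?posrE// mulr_gt0//; lra.
apply: (@le_trans _ _ (2 * CL * y / A y + 2 * C * (y / (k * A y)))).
  have C2 : 0 <= 2 * C by rewrite mulr_ge0.
  have := ler_wpM2l C2 yk.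
  rewrite lerD2l (_ : C * (2 * y) / A (2 * y) = 2 * C * (y / A (2 * y)))//.
  by ring.
rewrite le_eqVlt; apply/orP; left; apply/eqP; rewrite /C.
by field; rewrite !gt_eqF//; lra.
Qed.

End LeftTailMean.

End Moments.

(** * The mass of the tilted law *)

Section ExpBounds.
Context (R : realType).

Lemma expR_chord (t v : R) : 0 <= t -> t <= 1 ->
  expR (t * v) <= 1 + t * (expR v - 1).
Proof.
move=> t0 t1; have e0 := expR_gt0 (t * v).
(* both ends of the chord lie above the tangent at [t * v] *)
have tangent (x : R) : expR (t * v) * (1 + (x - t * v)) <= expR x.
  have -> : expR x = expR (t * v) * expR (x - t * v).
    by rewrite -expRD; congr expR; ring.
  by rewrite ler_wpM2l ?expR_ge1Dx// ltW.
have t1' : 0 <= 1 - t by lra.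
have := ler_wpM2l t1' (tangent 0); have := ler_wpM2l t0 (tangent v).
by rewrite expR0 => ? ?; lra.
Qed.

(** For [u <= 0] this follows from [expR u <= (1 - u)^-1], for [0 < u <= 1]
from the same bound at [u / 2]. *)
Lemma expR_le_quadratic (u : R) : u <= 1 -> expR u <= 1 + u + 3 * u ^+ 2.
Proof.
move=> u1; have inv (x : R) : x < 1 -> expR x <= (1 - x)^-1.
  move=> x1; have := expR_ge1Dx (- x); rewrite expRN => h.
  by rewrite -(invrK (expR x)) lef_pV2 ?posrE ?invr_gt0 ?expR_gt0//; lra.
have [u0|u0] := leP u 0.
  apply: (le_trans (inv u _)); first lra.
  rewrite -[leLHS]mul1r ler_pdivrMr; last lra.
  have := sqr_ge0 u; have : 0 <= - u by lra.
  by move=> a b; have := mulr_ge0 a b; rewrite !expr2; nra.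
have -> : u = u / 2 + u / 2 by field.
rewrite expRD -expr2; have h2 : u / 2 < 1 by lra.
have := inv _ h2; set e := expR (u / 2) => he.
have e0 : 0 <= e by exact: expR_ge0.
apply: (@le_trans _ _ ((1 - u / 2)^-1 ^+ 2)).
  by rewrite ler_sqr ?nnegrE// (le_trans e0).
rewrite exprVn -[leLHS]mul1r ler_pdivrMr; last by apply: exprn_gt0; lra.
have : 0 <= 9 / 4 - 11 / 4 * u + 3 / 4 * u ^+ 2 by nra.
have := sqr_ge0 u => a b; have := mulr_ge0 a b; lra.
Qed.

(** The quotient of [expR u - 1 - u] by [u ^+ 2] is, up to a constant,
increasing: it is bounded for [u <= 1], while for larger [u] the square root
[expR (u / 2)] may be bounded by its chord. *)
Lemma expR_le_quadratic_chord (lam y z : R) : 0 <= lam -> 0 < y ->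
  - y <= z -> z <= y ->
  expR (lam * z) <= 1 + lam * z + 6 * (expR (lam * y) / y ^+ 2) * z ^+ 2.
Proof.
move=> l0 y0 yz zy; have ly0 : 0 <= lam * y by rewrite mulr_ge0// ltW.
have z2 := sqr_ge0 z; have y2 : 0 < y ^+ 2 by exact: exprn_gt0.
have := expR_ge1Dxn 1 ly0; rewrite (_ : (2`!)%:R = 2) // => e2.
set E := expR (lam * y) in e2 *.
have [u1|u1] := leP (lam * z) 1.
  apply: (le_trans (expR_le_quadratic u1)); rewrite lerD2l.
  rewrite exprMn.
  have -> : 6 * (E / y ^+ 2) * z ^+ 2 = 6 * z ^+ 2 / y ^+ 2 * E.
    by ring.
  apply: (@le_trans _ _ (6 * z ^+ 2 / y ^+ 2 * ((lam * y) ^+ 2 / 2))).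
    rewrite le_eqVlt; apply/orP; left; apply/eqP; rewrite exprMn.
    by field; rewrite gt_eqF.
  rewrite ler_wpM2l//; last lra.
  by apply: divr_ge0; [exact: mulr_ge0|exact: ltW].
have z0 : 0 < z.
  by rewrite ltNge; apply/negP => z0; have := mulr_ge0_le0 l0 z0; lra.
pose t := z / y.
have t0 : 0 <= t by rewrite divr_ge0// ltW.
have t1 : t <= 1 by rewrite ler_pdivrMr// mul1r.
have := expR_chord (lam * y / 2) t0 t1.
have -> : t * (lam * y / 2) = lam * z / 2 by rewrite /t; field; rewrite gt_eqF.
set c := expR (lam * z / 2); set h := expR (lam * y / 2) => ch.
have c0 : 0 <= c by exact: expR_ge0.
have -> : expR (lam * z) = c ^+ 2 by rewrite expr2 -expRD; congr expR; field.
have hE : E = h ^+ 2 by rewrite /E expr2 -expRD; congr expR; field.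
have -> : 6 * (E / y ^+ 2) * z ^+ 2 = 6 * (t * h) ^+ 2.
  by rewrite hE /t; field; rewrite gt_eqF.
have th : 0 <= t * h by rewrite mulr_ge0// expR_ge0.
have c1 : c <= 1 + t * h by rewrite (le_trans ch)// mulrBr; lra.
have : c ^+ 2 <= (1 + t * h) ^+ 2 by rewrite ler_sqr ?nnegrE//; lra.
have := sqr_ge0 (1 - t * h); have := sqr_ge0 (t * h).
rewrite -[(1 - _) ^+ 2]/(_ * _) -[(1 + _) ^+ 2]/(_ * _).
by rewrite -[(t * h) ^+ 2]/(_ * _); lra.
Qed.

End ExpBounds.

Section TiltedMass.
Context (R : realType) (alpha : R) (A : R -> R).
Hypothesis halpha : (0 < alpha < 1) || (1 < alpha < 2).
Hypothesis hA : normalized_scale alpha A.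
Variable F : probability (measurableTypeR R) R.

Let A0 (s : R) : 0 <= s -> 0 < A s. Proof. exact: (scale_gt0 hA). Qed.

Lemma alpha_gt0 : 0 < alpha.
Proof. by case/orP: halpha => /andP[? ?]; lra. Qed.

Definition tilt (lam y z : R) : R := \1_(`]-oo, y]) z * expR (lam * z).

Lemma measurable_expRM (lam : R) :
  measurable_fun [set: R] (fun z : R => expR (lam * z)).
Proof.
apply: (measurableT_comp (@measurable_expR R)).
by apply: measurable_funM => //; exact: measurable_cst.
Qed.

Lemma bmfun_tilt (lam y : R) : 0 <= lam -> bmfun (tilt lam y).
Proof.
move=> l0; apply: (@bmfun_indicM _ _ _ _ _ (expR (lam * y))).
- exact: measurable_itv.
- exact: measurable_expRM.
move=> z /=; rewrite in_itv/= => zy; rewrite gtr0_norm ?expR_gt0// ler_expR.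
by rewrite ler_wpM2l.
Qed.

Lemma tiltE (lam y z : R) : tilt lam y z = if z <= y then expR (lam * z) else 0.
Proof.
rewrite /tilt indicE mem_setE in_itv/=.
by case: (z <= y)%R; rewrite ?mul1r ?mul0r.
Qed.

Variables CR CL : R.
Hypothesis CR1 : 1 <= CR.
Hypothesis CL1 : 1 <= CL.
Hypothesis right_tail :
  forall x, 0 <= x -> fine (F `]x, +oo[%classic) <= CR / A x.
Hypothesis left_tail :
  forall x, 0 <= x -> fine (F `]-oo, - x]%classic) <= CL / A x.
Hypothesis hmean :
  1 < alpha -> ('E_F[fun y : measurableTypeR R => (y : R)] = 0)%E.

Let centered : 1 < alpha -> F.-integrable setT (EFin \o (fun z : R => z)) /\
  mean F (fun z => z) = 0.
Proof.
move=> /hmean; rewrite unlock => E0.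
have mid : measurable_fun [set: measurableTypeR R] (EFin \o (fun z : R => z)).
  by apply/measurable_EFinP.
split; last by rewrite /mean /Rintegral E0.
apply/integrableP; split => //.
rewrite integral_fin_num_abs; first by rewrite E0.
all: by [].
Qed.

Let tilted_mass_lt1 : alpha < 1 -> exists C y0, [/\ 0 <= C, 1 <= y0 &
  forall y B, y0 <= y -> 1 <= B ->
    mean F (tilt (ln B / y) y) <= 1 + C * (B / A y)].
Proof.
move=> alpha1.
have [C [y0 [C0 y01 H]]] :=
  positive_part_truncated_mean alpha_gt0 hA CR1 right_tail alpha1.
exists C, y0; split => // y B y0y B1.
have y_gt0 : 0 < y by lra.
have B0 : 0 < B by lra.
have l0 : 0 <= ln B / y by rewrite divr_ge0 ?ln_ge0// ltW.
have bI : bmfun (fun z : R => \1_(`]0, y]) z * z).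
  apply: (@bmfun_indicM _ _ _ _ id y) => // z /=.
  by rewrite in_itv /= => /andP[z0 zy]; rewrite gtr0_norm.
have bBI : bmfun (fun z : R => B / y * (\1_(`]0, y]) z * z)).
  exact: (bmfunM (bmfun_cst _ (B / y)) bI).
apply: (@le_trans _ _ (1 + B / y * mean F (fun z => \1_(`]0, y]) z * z))).
  rewrite -meanZ// -[X in X + _](mean_const F 1) -meanD//; last first.
    exact: bmfun_cst.
  apply: le_mean; [exact: bmfun_tilt| |move=> z].
    exact: (bmfunD (bmfun_cst _ 1) bBI).
  rewrite tiltE indicE mem_setE in_itv/=.
  case: (leP z y) => zy; last by rewrite andbF mul0r mulr0 addr0.
  case: (ltP 0 z) => z0 /=; last first.
    rewrite mul0r mulr0 addr0 -expR0 ler_expR.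
    exact: mulr_ge0_le0.
  rewrite mul1r.
  have t0 : 0 <= z / y by rewrite divr_ge0// ltW.
  have t1 : z / y <= 1 by rewrite ler_pdivrMr// mul1r.
  have := expR_chord (ln B) t0 t1; rewrite lnK ?posrE//.
  rewrite (_ : z / y * ln B = ln B / y * z); last by ring.
  move=> /le_trans; apply; rewrite lerD2l mulrBr mulr1.
  by rewrite (_ : B / y * z = z / y * B); [lra|ring].
rewrite lerD2l; have By : 0 <= B / y by rewrite divr_ge0// ltW.
apply: (le_trans (ler_wpM2l By (H y y0y))).
rewrite le_eqVlt; apply/orP; left; apply/eqP.
by field; rewrite !gt_eqF// A0// ltW.
Qed.

Let tilted_mass_gt1 : 1 < alpha -> alpha < 2 -> exists C y0,
  [/\ 0 <= C, 1 <= y0 & forall y B, y0 <= y -> 1 <= B ->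
    mean F (tilt (ln B / y) y) <= 1 + C * (B / A y)].
Proof.
move=> alpha1 alpha2; have [iid0 mean0] := centered alpha1.
have [C [y0 [C0 y01 H]]] :=
  truncated_second_moment alpha_gt0 hA CR1 CL1 right_tail left_tail alpha2.
have [D [y1 [D0 y11 HD]]] :=
  left_tail_mean alpha_gt0 hA CL1 left_tail iid0 alpha1.
exists (6 * C + D), (Num.max y0 y1); split.
- by rewrite addr_ge0// mulr_ge0.
- by rewrite le_max y01.
move=> y B; rewrite ge_max => /andP[y0y y1y] B1.
have y_gt0 : 0 < y by lra.
have B0 : 0 < B by lra.
have l0 : 0 <= ln B / y by rewrite divr_ge0 ?ln_ge0// ltW.
set lam := ln B / y in l0 *.
have lamy : lam * y = ln B by rewrite /lam; field; rewrite gt_eqF.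
have Ay : 0 < A y by apply: A0; exact: ltW.
have bI : bmfun (fun z : R => \1_(`[- y, y]) z * z ^+ 2).
  apply: (@bmfun_indicM _ _ _ _ _ (y ^+ 2)) => // z /=.
  rewrite in_itv /= => /andP[z0 zy]; rewrite ger0_norm ?sqr_ge0//.
  have k1 : 0 <= y - z by lra.
  have k2 : 0 <= y + z by lra.
  by have := mulr_ge0 k1 k2; lra.
have c0 : 0 <= 6 * (B / y ^+ 2) by rewrite mulr_ge0// divr_ge0 ?sqr_ge0// ltW.
have i1 := bmfun_integrable F (bmfun_cst (measurableTypeR R) 1).
have i2 : F.-integrable setT (EFin \o (fun z => lam * z)).
  exact: (integrableZl measurableT lam iid0).
have i3 : F.-integrable setT
    (EFin \o (fun z => 6 * (B / y ^+ 2) * (\1_(`[- y, y]) z * z ^+ 2))).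
  exact: (bmfun_integrable F (bmfunM (bmfun_cst _ (6 * (B / y ^+ 2))) bI)).
have i4' : F.-integrable setT (EFin \o (fun z : R => \1_(`]-oo, - y[) z * - z)).
  apply: (le_integrable measurableT) iid0.
    apply/measurable_EFinP; apply: measurable_funM; last exact: measurable_funN.
    by apply: measurable_indic; exact: measurable_itv.
  move=> z _ /=; rewrite lee_fin indicE mem_setE in_itv/=.
  by case: (z < - y)%R; rewrite ?mul1r ?normrN// mul0r normr0.
have i4 : F.-integrable setT
    (EFin \o (fun z : R => lam * (\1_(`]-oo, - y[) z * - z))).
  exact: (integrableZl measurableT lam i4').
have i12 := integrableD measurableT i1 i2.
have i34 := integrableD measurableT i3 i4.
have i1234 := integrableD measurableT i12 i34.
apply: (@le_trans _ _ (\int[F]_z ((1 + lam * z) +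
    (6 * (B / y ^+ 2) * (\1_(`[- y, y]) z * z ^+ 2) +
     lam * (\1_(`]-oo, - y[) z * - z))))).
  apply: le_Rintegral => //.
    exact: (bmfun_integrable F (bmfun_tilt _ l0)).
  move=> z _; rewrite tiltE !indicE !mem_setE !in_itv/=.
  have [zy|yz] := leP z y; last first.
    have z0 : 0 < z by exact: lt_trans yz.
    have -> : (z < - y) = false.
      by apply/negbTE; rewrite -leNgt (@le_trans _ _ 0) ?oppr_le0 ?ltW.
    by rewrite andbF !mul0r !mulr0 !addr0 addr_ge0// mulr_ge0// ltW.
  have [yz|zy'] := leP (- y) z; last first.
    rewrite /= mul0r mulr0 add0r mul1r mulrN addrK.
    rewrite -expR0 ler_expR; apply: mulr_ge0_le0 => //.
    by rewrite (le_trans (ltW zy'))// oppr_le0 ltW.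
  rewrite /= mul0r mulr0 addr0 mul1r.
  by have := expR_le_quadratic_chord l0 y_gt0 yz zy; rewrite lamy lnK ?posrE.
rewrite (RintegralD measurableT i12 i34) (RintegralD measurableT i1 i2).
rewrite (RintegralD measurableT i3 i4).
rewrite [X in X + _ + _ <= _](_ : _ = 1); last exact: mean_const.
rewrite (RintegralZl lam measurableT iid0) (RintegralZl lam measurableT i4').
rewrite [Rintegral F setT (fun z => z)](mean0).
rewrite mulr0 addr0 lerD2l.
apply: (@le_trans _ _ (6 * (B / y ^+ 2) * (C * y ^+ 2 / A y) +
                       lam * (D * y / A y))).
  apply: lerD; last by apply: ler_wpM2l => //; exact: HD.
  rewrite -[leLHS]/(mean F (fun z => 6 * (B / y ^+ 2) *
    (\1_(`[- y, y]) z * z ^+ 2))) meanZ//.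
  by apply: ler_wpM2l => //; exact: H.
rewrite (_ : 6 * (B / y ^+ 2) * (C * y ^+ 2 / A y) = 6 * C * (B / A y));
  last first.
  by field; rewrite !gt_eqF.
rewrite (_ : lam * (D * y / A y) = D * (ln B / A y)); last first.
  by rewrite /lam; field; rewrite !gt_eqF.
rewrite [leRHS]mulrDl; apply: lerD => //; apply: ler_wpM2l => //.
by rewrite ler_wpM2r ?invr_ge0 ?(ltW Ay)// ltW// ln_sublinear.
Qed.

(** With [lam = ln B / y] the weight [expR (lam * z)] stays below [B] on the
truncated range. For [alpha < 1] its excess over [1] is controlled by its
chord on [[0, y]] and the truncated first moment; for [alpha > 1] the linear
term is removed by centering, and what remains is quadratic. *)
Lemma tilted_mass : exists C y0, [/\ 0 <= C, 1 <= y0 &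
  forall y B, y0 <= y -> 1 <= B ->
    mean F (tilt (ln B / y) y) <= 1 + C * (B / A y)].
Proof.
case/orP: halpha => /andP[? ?]; first exact: tilted_mass_lt1.
exact: tilted_mass_gt1.
Qed.

End TiltedMass.

(** * Concentration by a discrete Fourier argument *)

Section Trigonometry.
Context (R : realType).

Let lipschitz (f df : R -> R) (x y : R) :
  (forall z : R, is_derive z (1 : R) f (df z)) ->
  (forall z, `|df z| <= 1) ->
  `|f x - f y| <= `|x - y|.
Proof.
move=> fd df1; wlog xy : x y / y <= x.
  by move=> H; case: (leP y x) => [/H//|/ltW/H]; rewrite distrC (distrC y).
have cf : {within `[y, x], continuous f}.
  by apply: derivable_within_continuous => z _; apply: ex_derive.
have [c _ ->] := MVT_segment xy (fun z _ => fd z) cf.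
by rewrite normrM ler_piMl.
Qed.

Lemma sin_le_norm (x : R) : `|sin x| <= `|x|.
Proof.
have := @lipschitz sin cos x 0 (fun z => is_derive_sin z) (@cos_max R).
by rewrite sin0 !subr0.
Qed.

Lemma cos_ge_half (x : R) : `|x| <= 2^-1 -> 2^-1 <= cos x.
Proof.
move=> x2; have := @lipschitz cos (fun z => - sin z) x 0
  (fun z => is_derive_cos z) (fun z => _).
rewrite cos0 subr0 => /(_ _)/le_trans/(_ x2) H.
have /ler_normlP[] : `|cos x - 1| <= 2^-1.
  by apply: H => z; rewrite normrN sin_max.
by lra.
Qed.


Lemma wave_le (a b : R) (rho x : R) (n : nat) : 0 <= rho ->
  a ^+ 2 + b ^+ 2 <= (rho ^+ n) ^+ 2 -> a * cos x + b * sin x <= rho ^+ n.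
Proof.
move=> r0 ab; have rn0 : 0 <= rho ^+ n by exact: exprn_ge0.
have := cos2Dsin2 x; set c := cos x; set s := sin x => cs.
apply: le_trans (ler_norm _) _.
rewrite -(ler_pXn2r (n := 2)) ?nnegrE// real_normK ?num_real//.
apply: le_trans ab; rewrite -subr_ge0.
have -> : a ^+ 2 + b ^+ 2 - (a * c + b * s) ^+ 2 =
    (a ^+ 2 + b ^+ 2) * (1 - (c ^+ 2 + s ^+ 2)) + (a * s - b * c) ^+ 2 by ring.
by rewrite cs subrr mulr0 add0r sqr_ge0.
Qed.

End Trigonometry.

Section CharacteristicFunction.
Context (R : realType) (F : probability (measurableTypeR R) R).
Variable w : R -> R.
Hypothesis bw : bmfun w.

Lemma bmfun_cosM (t x : R) : bmfun (fun s : R => cos (t * (s - x))).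
Proof.
split; last by exists 1 => s; exact: cos_max.
apply: (measurableT_comp (continuous_measurable_fun (@continuous_cos R))).
by apply: measurable_funM => //; exact: measurable_funB.
Qed.

Lemma bmfun_sinM (t x : R) : bmfun (fun s : R => sin (t * (s - x))).
Proof.
split; last by exists 1 => s; exact: sin_max.
apply: (measurableT_comp (continuous_measurable_fun (@continuous_sin R))).
by apply: measurable_funM => //; exact: measurable_funB.
Qed.

Let cosc t := mean F (fun z => w z * cos (t * (z - 0))).
Let sinc t := mean F (fun z => w z * sin (t * (z - 0))).

Let bcos t : bmfun (fun z => w z * cos (t * (z - 0))).
Proof. exact: (bmfunM bw (bmfun_cosM t 0)). Qed.

Let bsin t : bmfun (fun z => w z * sin (t * (z - 0))).
Proof. exact: (bmfunM bw (bmfun_sinM t 0)). Qed.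

(** The transfer operator maps waves to waves of the same frequency and
multiplies their amplitude by the modulus of the characteristic function.
That this modulus is at most [rho] is expressed by testing against all unit
vectors [(u, v)]; a nonzero value is tested against its own direction. *)
Lemma iter_step_cos (n : nat) (t x s : R) (rho : R) : 0 <= rho ->
  (forall u v, u ^+ 2 + v ^+ 2 = 1 ->
     mean F (fun z => w z * (u * cos (t * (z - 0)) + v * sin (t * (z - 0))))
     <= rho) ->
  iter n (step F w) (fun s => cos (t * (s - x))) s <= rho ^+ n.
Proof.
move=> r0 hrho.
have phase (a b : R) :
    mean F (fun z => w z * (a * cos (t * (z - 0)) + b * sin (t * (z - 0)))) =
    a * cosc t + b * sinc t.
  rewrite /cosc /sinc -(meanZ F a (bcos t)) -(meanZ F b (bsin t)) -meanD.
  - by congr mean; apply/funext => z; ring.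
  - exact: (bmfunM (bmfun_cst _ a) (bcos t)).
  - exact: (bmfunM (bmfun_cst _ b) (bsin t)).
have cs_rho : cosc t ^+ 2 + sinc t ^+ 2 <= rho ^+ 2.
  pose q := Num.sqrt (cosc t ^+ 2 + sinc t ^+ 2).
  have cs0 : 0 <= cosc t ^+ 2 + sinc t ^+ 2 by rewrite addr_ge0 ?sqr_ge0.
  have q2 : q ^+ 2 = cosc t ^+ 2 + sinc t ^+ 2 by rewrite sqr_sqrtr.
  have q0 : 0 <= q by exact: sqrtr_ge0.
  rewrite -q2 ler_pXn2r ?nnegrE//.
  have [->//|qn0] := eqVneq q 0.
  have := hrho (cosc t / q) (sinc t / q).
  rewrite phase !exprMn -mulrDl -q2 exprVn divff ?expf_neq0// => /(_ erefl).
  rewrite mulrAC [X in _ + X]mulrAC -!expr2 -mulrDl -q2 expr2 mulfK//.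
have [a [b [ab ->]]] : exists a b, a ^+ 2 + b ^+ 2 <= (rho ^+ n) ^+ 2 /\
    iter n (step F w) (fun s => cos (t * (s - x))) =
    (fun s => a * cos (t * (s - x)) + b * sin (t * (s - x))).
  elim: n => [|n [a [b [ab IH]]]].
    exists 1, 0; split; first by rewrite !expr0 !expr1n expr0n addr0.
    by apply/funext => y /=; rewrite mul1r mul0r addr0.
  exists (a * cosc t + b * sinc t), (b * cosc t - a * sinc t); split.
    have -> : (a * cosc t + b * sinc t) ^+ 2 + (b * cosc t - a * sinc t) ^+ 2 =
      (a ^+ 2 + b ^+ 2) * (cosc t ^+ 2 + sinc t ^+ 2) by ring.
    rewrite [rho ^+ n.+1]exprS exprMn [leRHS]mulrC; apply: ler_pM => //.
      by rewrite addr_ge0 ?sqr_ge0.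
    by rewrite addr_ge0 ?sqr_ge0.
  rewrite iterS IH; apply/funext => y; rewrite /step.
  set th := t * (y - x).
  rewrite [RHS](_ : _ = (a * cos th + b * sin th) * cosc t +
                       (b * cos th - a * sin th) * sinc t); last by ring.
  rewrite -phase; congr mean; apply/funext => z.
  have -> : t * (y + z - x) = th + t * (z - 0) by rewrite /th; ring.
  by rewrite cosD sinD; ring.
exact: wave_le.
Qed.

End CharacteristicFunction.

Section FejerSums.
Context (R : realType).

Lemma sum_inv_sqr_le (N : nat) :
  \sum_(0 <= m < N) (m.+1%:R ^+ 2)^-1 <= 2 :> R.
Proof.
suff H : \sum_(0 <= m < N.+1) (m.+1%:R ^+ 2)^-1 <= 2 - N.+1%:R^-1 :> R.
  apply: (@le_trans _ _ (\sum_(0 <= m < N.+1) (m.+1%:R ^+ 2)^-1)).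
    by rewrite big_nat_recr//= lerDl invr_ge0 sqr_ge0.
  by apply: le_trans H _; rewrite lerBlDr lerDl invr_ge0.
elim: N => [|N IH]; first by rewrite big_nat1 expr1n invr1; lra.
rewrite big_nat_recr//=; apply: (le_trans (lerD IH (lexx _))).
rewrite -subr_ge0.
have n1 : (0 : R) < N.+1%:R by rewrite ltr0n.
rewrite -[N.+2]addn1 natrD; set u := N.+1%:R in n1 *.
have -> : 2 - (u + 1)^-1 - (2 - u^-1 + ((u + 1) ^+ 2)^-1) =
    (u * (u + 1) ^+ 2)^-1.
  by field; rewrite gt_eqF//= gt_eqF//; lra.
by rewrite invr_ge0 mulr_ge0 ?sqr_ge0// ltW.
Qed.

(** Each row of the matrix [q `|j - k|] is covered by two copies of [q]. *)
Lemma double_sum_dist_le (N : nat) (q : nat -> R) : (forall m, 0 <= q m) ->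
  \sum_(j < N) \sum_(k < N) q (maxn j k - minn j k)%N <=
  N%:R * (2 * \sum_(0 <= m < N) q m).
Proof.
move=> q0; rewrite -[leRHS](_ : \sum_(j < N) (2 * \sum_(0 <= m < N) q m) = _).
  apply: ler_sum => j _.
  rewrite -(big_mkord xpredT (fun k => q (maxn j k - minn j k)%N)).
  rewrite (@big_cat_nat _ _ _ j)//=; last exact: ltnW.
  rewrite mulr_natl mulr2n; apply: lerD.
    rewrite big_nat_rev/= add0n.
    apply: (@le_trans _ _ (\sum_(0 <= m < j.+1) q m)).
      rewrite big_nat_recl//=.
      rewrite (@eq_big_nat _ _ _ 0 j _ (fun m => q m.+1)); last first.
        move=> m /andP[_ mj]; rewrite (maxn_idPl (leq_subr _ _)).
        by rewrite (minn_idPr (leq_subr _ _)) subKn.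
      by rewrite lerDr.
    by rewrite [leRHS](@big_cat_nat _ _ _ j.+1)//= lerDl sumr_ge0.
  rewrite -{1}[nat_of_ord j]add0n big_addn.
  rewrite (@eq_big_nat _ _ _ 0 (N - j) _ q); last first.
    move=> m _; rewrite (maxn_idPr (leq_addl _ _)) (minn_idPl (leq_addl _ _)).
    by rewrite addnK.
  rewrite [leRHS](@big_cat_nat _ _ _ (N - j)%N)//= ?leq_subr//.
  by rewrite lerDl sumr_ge0.
by rewrite sumr_const card_ord [RHS]mulr_natl.
Qed.

End FejerSums.

Section FejerConcentration.
Context (R : realType) (F : probability (measurableTypeR R) R).

(** The Fejer kernel [|\sum_(j < N) exp (i * j * theta * (s - x))| ^+ 2] is at
least [(N / 2) ^+ 2] near [x], and it is a sum of [N ^+ 2] waves. *)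
Lemma fejer_concentration (w : R -> R) (n N : nat) (theta h x s : R)
    (q : nat -> R) :
  bmfun w -> (forall z, 0 <= w z) -> (0 < N)%N -> 0 <= theta ->
  N%:R * theta * h <= 2^-1 -> (forall m, 0 <= q m) ->
  (forall m, (m < N)%N ->
     iter n (step F w) (fun s => cos (m%:R * theta * (s - x))) s <= q m) ->
  iter n (step F w) \1_(`[x - h, x + h]) s <=
  8 / N%:R * \sum_(0 <= m < N) q m.
Proof.
move=> bw w0 N0 th0 Nh q0 Hq.
have N_gt0 : (0 : R) < N%:R by rewrite ltr0n.
pose e (j k : 'I_N) (y : R) :=
  cos ((maxn j k - minn j k)%:R * theta * (y - x)).
pose K y := \sum_(j < N) \sum_(k < N) e j k y.
have KE y : K y = (\sum_(j < N) cos (j%:R * theta * (y - x))) ^+ 2 +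
                  (\sum_(j < N) sin (j%:R * theta * (y - x))) ^+ 2.
  rewrite !expr2 !mulr_suml -big_split/=; apply: eq_bigr => j _.
  rewrite !mulr_sumr -big_split/=; apply: eq_bigr => k _.
  rewrite -cosB /e -mulrBl -mulrBl.
  case: (leqP j k) => jk; first by rewrite natrB// -opprB !mulNr cosN.
  by rewrite natrB// ltnW.
have be j k : bmfun (e j k) by exact: bmfun_cosM.
have bsum j : bmfun (fun y => \sum_(k < N) e j k y) by exact: bmfun_sum.
have bK : bmfun K by exact: bmfun_sum.
have bc : bmfun (fun y => 4 / N%:R ^+ 2 * K y).
  exact: (bmfunM (bmfun_cst _ _) bK).
have bi : bmfun (\1_(`[x - h, x + h]) : R -> R).
  by apply: bmfun_indic; exact: measurable_itv.
have i0 z : 0 <= \1_(`[x - h, x + h]) z :> R by [].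
have iK z : \1_(`[x - h, x + h]) z <= 4 / N%:R ^+ 2 * K z.
  have K0 : 0 <= K z by rewrite KE addr_ge0 ?sqr_ge0.
  rewrite indicE mem_setE in_itv/=.
  case: (boolP (_ && _)) => [/andP[xz zx]|_]; last first.
    by rewrite mulr_ge0// divr_ge0// sqr_ge0.
  have cosj (j : 'I_N) : 2^-1 <= cos (j%:R * theta * (z - x)).
    apply: cos_ge_half; rewrite normrM ger0_norm ?mulr_ge0//.
    apply: le_trans Nh; apply: ler_pM; rewrite ?mulr_ge0//.
      by rewrite ler_wpM2r// ler_nat ltnW.
    by rewrite ler_norml; lra.
  have sumc : N%:R / 2 <= \sum_(j < N) cos (j%:R * theta * (z - x)).
    apply: (@le_trans _ _ (\sum_(j < N) 2^-1)); last by apply: ler_sum.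
    by rewrite sumr_const card_ord mulr_natl.
  have : (N%:R / 2) ^+ 2 <= K z.
    rewrite KE; apply: ler_wpDr; first exact: sqr_ge0.
    rewrite ler_pXn2r ?nnegrE ?divr_ge0//.
    by apply: le_trans sumc; rewrite divr_ge0.
  move=> NK; rewrite -[true%:R]/1.
  rewrite [leLHS](_ : 1 = 4 / N%:R ^+ 2 * (N%:R / 2) ^+ 2); last first.
    by field; rewrite gt_eqF.
  by rewrite ler_wpM2l// divr_ge0// sqr_ge0.
apply: (le_trans (le_iter_step F n s bw bw bi bc w0 (fun=> lexx _) i0 iK)).
rewrite iter_stepZ// iter_step_sum//.
apply: (@le_trans _ _ (4 / N%:R ^+ 2 * (N%:R * (2 * \sum_(0 <= m < N) q m)))).
  rewrite ler_wpM2l ?divr_ge0 ?sqr_ge0//.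
  apply: le_trans (double_sum_dist_le N q0).
  apply: ler_sum => j _; rewrite iter_step_sum//; apply: ler_sum => k _.
  by apply: Hq; rewrite (leq_ltn_trans (leq_subr _ _))// gtn_max !ltn_ord.
rewrite le_eqVlt; apply/orP; left; apply/eqP.
by field; rewrite gt_eqF.
Qed.

(** Either the phase [(u, v)] is close to [(1, 0)], and it is missed by the
points of the window [(r, 2 * r]], where [t * z] lies in [[pi / 2, pi]]; or
it is missed by the points [z] near the origin, where [t * z] is close to
[0]. *)
Lemma phase_defect (w : R -> R) (b0 w0 r u v : R) :
  bmfun w -> (forall z, 0 <= w z) ->
  0 <= w0 -> (forall z : R, - b0 <= z -> z <= b0 -> w0 <= w z) ->
  2^-1 <= fine (F `[- b0, b0]%classic) ->
  0 < r -> (forall z : R, 0 <= z -> z <= 2 * r -> 1 <= w z) ->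
  64 * b0 * (pi / (2 * r)) <= 1 ->
  u ^+ 2 + v ^+ 2 = 1 ->
  mean F (fun z => w z * (u * cos (pi / (2 * r) * (z - 0)) +
                          v * sin (pi / (2 * r) * (z - 0)))) <=
  mean F w - Num.min (2^-1 * fine (F `]r, 2 * r]%classic)) (w0 / 128).
Proof.
move=> bw wge0 w00 ww0 Fb0 r0 w1 tb0 uv; set t := pi / (2 * r) in tb0 *.
have t_gt0 : 0 < t by rewrite divr_gt0 ?pi_gt0// mulr_gt0.
have u1 : `|u| <= 1.
  rewrite -(ler_pXn2r (n := 2)) ?nnegrE// real_normK ?num_real// expr1n -uv.
  by rewrite lerDl sqr_ge0.
pose d (z : R) : R := 1 - (u * cos (t * (z - 0)) + v * sin (t * (z - 0))).
have d0 (z : R) : 0 <= d z.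
  rewrite /d subr_ge0 -[leRHS](expr1n _ 1).
  by apply: wave_le => //; rewrite !expr1n uv.
have bwave : bmfun (fun z : R => u * cos (t * (z - 0)) + v * sin (t * (z - 0))).
  apply: bmfunD; first exact: (bmfunM (bmfun_cst _ u) (bmfun_cosM t 0)).
  exact: (bmfunM (bmfun_cst _ v) (bmfun_sinM t 0)).
have bd : bmfun d by exact: (bmfunB (bmfun_cst _ 1) bwave).
have bwd : bmfun (fun z => w z * d z) by exact: bmfunM.
have -> : mean F (fun z => w z * (u * cos (t * (z - 0)) +
    v * sin (t * (z - 0)))) = mean F w - mean F (fun z => w z * d z).
  rewrite -meanB//; congr mean; apply/funext => z; rewrite /d; ring.
rewrite lerD2l lerN2.
have lower (B : set R) (k : R) : measurable B ->
    (forall z, B z -> k <= w z * d z) ->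
    k * fine (F B) <= mean F (fun z => w z * d z).
  move=> mB Bk; have bB : bmfun (\1_B : R -> R) by exact: bmfun_indic.
  rewrite -mean_indic// -meanZ//; apply: le_mean => //.
    exact: (bmfunM (bmfun_cst _ k) bB).
  move=> z; rewrite indicE; case: (boolP (z \in B)) => [/set_mem /Bk|_].
    by rewrite mulr1.
  by rewrite mulr0 mulr_ge0.
have [/andP[v4 u0]|uv4] := boolP ((`|v| <= 2^-1) && (0 <= u)).
  rewrite ge_min; apply/orP; left; apply: lower; first exact: measurable_itv.
  move=> z /=; rewrite in_itv/= => /andP[rz z2r].
  have z0 : 0 <= z by rewrite (le_trans (ltW r0))// ltW.
  rewrite -[leLHS]mul1r; apply: ler_pM => //; first exact: w1.
  have cosz : cos (t * (z - 0)) <= 0.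
    rewrite subr0 -[t * z](subrK pi) cosDpi oppr_le0 cos_ge0_pihalf//.
    have -> : t * z = pi * (z / (2 * r)) by rewrite /t; field; rewrite gt_eqF.
    have l1 : 2^-1 <= z / (2 * r) by rewrite ler_pdivlMr ?mulr_gt0//; lra.
    have l2 : z / (2 * r) <= 1 by rewrite ler_pdivrMr ?mulr_gt0//; lra.
    have p0 := @pi_ge0 R.
    have := ler_wpM2l p0 l1; have := ler_wpM2l p0 l2; lra.
  have := mulr_ge0_le0 u0 cosz.
  have : v * sin (t * (z - 0)) <= `|v|.
    by rewrite (le_trans (ler_norm _))// normrM ler_piMr// sin_max.
  by rewrite /d; lra.
rewrite ge_min; apply/orP; right.
have u31 : u <= 31 / 32.
  move: uv4; rewrite negb_and -!ltNge => /orP[v2|]; last by lra.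
  rewrite leNgt; apply/negP => u31.
  have : (31 / 32) ^+ 2 < u ^+ 2 by rewrite ltr_pXn2r ?nnegrE//; lra.
  have : 2^-1 ^+ 2 < v ^+ 2.
    by rewrite -(real_normK (num_real v)) ltr_pXn2r ?nnegrE//; lra.
  by rewrite !expr2 in uv *; lra.
apply: (@le_trans _ _ (w0 / 64 * fine (F `[- b0, b0]%classic))).
  rewrite (_ : w0 / 128 = w0 / 64 * 2^-1); last by field.
  by rewrite ler_wpM2l// divr_ge0.
apply: lower; first exact: measurable_itv.
move=> z /=; rewrite in_itv/= => /andP[zb bz].
rewrite -[w0 / 64]/(w0 * 64^-1); apply: ler_pM => //; first exact: ww0.
have tz : `|t * (z - 0)| <= 64^-1.
  rewrite subr0 normrM gtr0_norm// (@le_trans _ _ (t * b0))//; last by lra.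
  by rewrite ler_wpM2l ?(ltW t_gt0)// ler_norml zb bz.
have v1 : `|v| <= 1.
  rewrite -(ler_pXn2r (n := 2)) ?nnegrE// real_normK ?num_real// expr1n -uv.
  by rewrite lerDr sqr_ge0.
have : v * sin (t * (z - 0)) <= 64^-1.
  rewrite (le_trans (ler_norm _))// normrM -[64^-1]mul1r ler_pM//.
  exact: le_trans (sin_le_norm _) tz.
have : u * cos (t * (z - 0)) <= 31 / 32.
  have [u0|u0] := leP u 0.
    have c0 : 0 <= cos (t * (z - 0)).
      apply: le_trans (cos_ge_half _); first by lra.
      by apply: le_trans tz _; lra.
    by have := mulr_le0_ge0 u0 c0; lra.
  apply: le_trans u31; rewrite ler_piMr ?(ltW u0)//; exact: cos_le1.
by rewrite /d; lra.
Qed.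

End FejerConcentration.

Section Concentration.
Context (R : realType) (alpha : R) (A : R -> R).
Hypothesis alpha0 : 0 < alpha.
Hypothesis hA : normalized_scale alpha A.
Variable F : probability (measurableTypeR R) R.

Let A0 (s : R) : 0 <= s -> 0 < A s. Proof. exact: (scale_gt0 hA). Qed.

(** [expR u >= u ^+ j / j`!] with [j] so large that [j * beta >= 2]. *)
Lemma expR_powR_decay (beta c : R) : 0 < beta -> 0 < c ->
  exists2 Q, 0 <= Q & forall m : nat, (0 < m)%N ->
    expR (- (c * m%:R `^ beta)) <= Q / m.+1%:R ^+ 2.
Proof.
move=> b0 c0; pose j := (Num.bound (2 / beta)).+1.
have j2 : 2 <= beta * j%:R.
  rewrite mulrC -ler_pdivrMr// ltW// (lt_trans (archi_boundP _))//.
    by rewrite divr_ge0// ltW.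
  by rewrite ltr_nat.
have fj : (0 : R) < j`!%:R by rewrite ltr0n fact_gt0.
have cj : 0 < c ^+ j by exact: exprn_gt0.
exists (4 * j`!%:R / c ^+ j).
  by apply: divr_ge0; [exact: mulr_ge0|exact: ltW].
move=> m m0; have mR : (1 : R) <= m%:R by rewrite ler1n.
have mb0 : 0 < m%:R `^ beta by rewrite powR_gt0//; lra.
have u0 : 0 < c * m%:R `^ beta by exact: mulr_gt0.
rewrite expRN.
have := expR_ge1Dxn (Num.bound (2 / beta)) (ltW u0); rewrite -/j => eu.
set u := c * _ in u0 eu *.
have uj : 0 < u ^+ j / j`!%:R by rewrite divr_gt0// exprn_gt0.
have : (expR u)^-1 <= (u ^+ j / j`!%:R)^-1.
  by rewrite lef_pV2 ?posrE ?expR_gt0//; lra.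
move=> /le_trans; apply.
have m2 : m%:R ^+ 2 <= (m%:R `^ beta) ^+ j :> R.
  rewrite -[leLHS]powR_mulrn// -[leRHS]powR_mulrn ?powR_ge0// -powRrM.
  exact: ler_powR.
have m4 : m.+1%:R ^+ 2 <= 4 * m%:R ^+ 2 :> R.
  rewrite (_ : 4 * m%:R ^+ 2 = (2 * m%:R) ^+ 2); last by rewrite exprMn; ring.
  rewrite ler_pXn2r ?nnegrE ?mulr_ge0// -addn1 natrD; lra.
rewrite ler_pdivlMr; last by rewrite exprn_gt0.
rewrite -ler_pdivlMl ?invr_gt0// invrK.
rewrite [leRHS](_ : _ = 4 * (m%:R `^ beta) ^+ j); last first.
  by rewrite /u exprMn; field; rewrite !gt_eqF.
by apply: (le_trans m4); rewrite ler_wpM2l.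
Qed.

Variables CR CL p : R.
Hypothesis CR1 : 1 <= CR.
Hypothesis CL1 : 1 <= CL.
Hypothesis right_tail :
  forall x, 0 <= x -> fine (F `]x, +oo[%classic) <= CR / A x.
Hypothesis left_tail :
  forall x, 0 <= x -> fine (F `]-oo, - x]%classic) <= CL / A x.

Lemma central_mass : exists2 b0, 1 <= b0 &
  2^-1 <= fine (F `[- b0, b0]%classic).
Proof.
have C1 := CR1; have C2 := CL1.
pose n := Num.bound (2 * (CR + CL)).
have nC : 2 * (CR + CL) < n%:R by apply: archi_boundP; lra.
have n1 : (1 <= n)%N by rewrite -(ltr0n R); lra.
have [b1 bn] := scale_inv_spec alpha0 hA n1.
exists (scale_inv A n%:R) => //; set b := scale_inv _ _ in b1 bn *.
have b0 : 0 <= b by lra.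
have bi (i : interval R) : bmfun (\1_[set` i] : R -> R).
  by apply: bmfun_indic; exact: measurable_itv.
have : mean F (fun=> 1) <= mean F (fun z => \1_(`]-oo, - b]) z +
    (\1_(`[- b, b]) z + \1_(`]b, +oo[) z)).
  apply: le_mean; first exact: bmfun_cst.
    exact: (bmfunD (bi _) (bmfunD (bi _) (bi _))).
  move=> z; rewrite !indicE !mem_setE !in_itv/= andbT.
  case: (leP z (- b)) => ?; case: (leP (- b) z) => ?;
  by case: (leP z b) => ? /=; lra.
rewrite mean_const meanD; [|exact: bi|exact: (bmfunD (bi _) (bi _))].
rewrite meanD; [|exact: bi|exact: bi].
rewrite !mean_indic; [|exact: measurable_itv..].
have := left_tail b0; have := right_tail b0; rewrite bn.
have n0 : (0 : R) < n%:R by lra.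
rewrite !ler_pdivlMr// => hr hl h1.
set x := fine (F `]-oo, - b]%classic) in hl h1.
set z := fine (F `]b, +oo[%classic) in hr h1.
suff : x + z < 2^-1 by lra.
by rewrite -(ltr_pM2r n0) mulrDl; lra.
Qed.

Variable b0 : R.
Hypothesis b01 : 1 <= b0.
Hypothesis central : 2^-1 <= fine (F `[- b0, b0]%classic).
Hypothesis hp : 0 < p.
Hypothesis hright :
  asymp_equiv (fun x => fine (F `]x, +oo[%classic)) (fun x => p / A x).

(** The characteristic function at frequency [pi / (2 * r)] is at distance at
least of order [1 / A r] from the total mass. At the [m]-th of [N ~ a_n]
equidistant frequencies [r] is of order [a_n / m], and the [n]-th power of
the characteristic function is of order at most [expR (- c * m `^ beta)],
which is summable in [m]. *)
Lemma concentration (h w0 M : R) : 0 <= h -> 0 < w0 -> 0 <= M ->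
  exists2 K, 0 <= K & forall (n : nat) (y : R) (w : R -> R), (1 <= n)%N ->
    scale_inv A n%:R <= y -> bmfun w -> (forall z, 0 <= w z) ->
    (forall z, 0 <= z -> z <= y -> 1 <= w z) ->
    (forall z, - b0 <= z -> z <= b0 -> w0 <= w z) ->
    mean F w <= 1 + M / n%:R ->
    forall x s, iter n (step F w) \1_(`[x - h, x + h]) s <=
                K / scale_inv A n%:R.
Proof.
move=> h0 w0_gt0 M0.
have a2 : alpha / 2 < alpha by rewrite ltr_pdivrMr// ltr_pMr// ltr1n.
have a1 : alpha < alpha + 1 by rewrite ltrDl.
have [s0 s01 HA] := scale_potter alpha0 hA a2 a1.
have [cw [r0 [cw0 r01 Hw]]] := right_window_ge alpha0 hA hp hright.
(* [H] keeps all the radii [r = N * H / m] in the asymptotic range, and all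
   the phases small on the window and on the central part of [F] *)
pose H := Num.max (Num.max s0 r0) (Num.max (128 * b0) (4 * h)).
have [Hs Hr Hb Hh] : [/\ s0 <= H, r0 <= H, 128 * b0 <= H & 4 * h <= H].
  by split; rewrite !le_max lexx ?orbT.
have H1 : 1 <= H by lra.
have H_gt0 : 0 < H by exact: lt_le_trans H1.
have H2 : 1 <= 2 * H by lra.
have [D D1 HD] := scale_doubling alpha0 hA H2.
pose c := Num.min (cw / 2) (w0 / 256).
have c0 : 0 < c.
  rewrite lt_min; apply/andP; split.
    exact: (divr_gt0 cw0 (ltr0Sn _ 1)).
  exact: (divr_gt0 w0_gt0 (ltr0Sn _ 255)).
have cD : 0 < c / D by rewrite divr_gt0//; lra.
have al2 : 0 < alpha / 2 by rewrite divr_gt0.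
have [Q1 Q10 HQ1] := expR_powR_decay al2 cD.
pose Q := expR M * Num.max Q1 ((4 * H + 1) ^+ 2).
have Q0 : 0 <= Q by rewrite mulr_ge0 ?expR_ge0// le_max Q10.
exists (16 * Q); first by rewrite mulr_ge0.
move=> n y w n1 ay bw wge0 w1 ww0 mw x s.
have [a_ge1 An] := scale_inv_spec alpha0 hA n1.
set a := scale_inv A n%:R in ay a_ge1 An *.
have a_gt0 : 0 < a by exact: lt_le_trans a_ge1.
have nR : (0 : R) < n%:R by rewrite ltr0n.
pose N := (Num.truncn a).+1.
have aN : a < N%:R by exact: truncnS_gt.
have Na : N%:R <= 2 * a.
  have -> : N%:R = (Num.truncn a)%:R + 1 :> R by rewrite natr1.
  have /andP[+ _] := truncn_itv (ltW a_gt0).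
  by lra.
have NR : (0 : R) < N%:R by rewrite ltr0n.
pose L := N%:R * H.
have L0 : 0 < L by rewrite mulr_gt0.
pose theta := pi / (2 * L).
have th0 : 0 <= theta by rewrite divr_ge0 ?pi_ge0// mulr_ge0// ltW.
have pi4 : pi <= 4 :> R by have [/andP[_ ?] _] := @pihalf_02_cos_pihalf R; lra.
pose q (m : nat) := Q / m.+1%:R ^+ 2.
have q0 m : 0 <= q m by rewrite divr_ge0// sqr_ge0.
have m0 : 0 <= mean F w by exact: mean_ge0.
have powM rho : 0 <= rho -> rho <= 1 + M / n%:R -> rho ^+ n <= expR M.
  move=> rho0 rho1; rewrite (_ : M = n%:R * (M / n%:R)); last first.
    by field; rewrite gt_eqF.
  rewrite expRM_natl ler_pXn2r ?nnegrE ?expR_ge0//.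
  exact: le_trans rho1 (expR_ge1Dx _).
apply: (le_trans (@fejer_concentration _ F w n N theta h x s q
  bw wge0 _ th0 _ q0 _)) => //.
- rewrite /theta /L (_ : _ * h = pi * h / (2 * H)); last first.
    by field; rewrite !gt_eqF//; lra.
  rewrite ler_pdivrMr; last by lra.
  have := ler_wpM2r h0 pi4; lra.
- move=> m mN.
  have Qm k : k <= Num.max Q1 ((4 * H + 1) ^+ 2) ->
      expR M * (k / m.+1%:R ^+ 2) <= q m.
    move=> kQ; rewrite /q /Q -mulrA ler_wpM2l ?expR_ge0//.
    by rewrite ler_wpM2r// invr_ge0 sqr_ge0.
  have bwave (u v t : R) :
      bmfun (fun z : R =>
        w z * (u * cos (t * (z - 0)) + v * sin (t * (z - 0)))).
    apply: bmfunM => //; apply: bmfunD.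
      exact: (bmfunM (bmfun_cst _ u) (bmfun_cosM t 0)).
    exact: (bmfunM (bmfun_cst _ v) (bmfun_sinM t 0)).
  have [m4|m4] := leP m%:R (4 * H).
    (* finitely many low frequencies, where the total mass suffices *)
    apply: (@le_trans _ _ (mean F w ^+ n)).
      apply: iter_step_cos => // u v uv.
      apply: le_mean; [exact: bwave|exact: bw|move=> z].
      rewrite ler_piMr//.
      by rewrite -[leRHS](expr1n _ 1); apply: wave_le => //; rewrite !expr1n uv.
    apply: (le_trans (powM _ m0 mw)).
    have Hm : (4 * H + 1) ^+ 2 <= Num.max Q1 ((4 * H + 1) ^+ 2).
      by rewrite le_max lexx orbT.
    apply: le_trans (Qm _ Hm); rewrite ler_peMr ?expR_ge0//.
    rewrite ler_pdivlMr ?exprn_gt0// mul1r ler_pXn2r ?nnegrE//; last by lra.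
    by rewrite -addn1 natrD; lra.
  have m_gt0 : (0 : R) < m%:R by apply: lt_trans m4; rewrite mulr_gt0.
  have mR : (1 : R) <= m%:R by rewrite ler1n -(ltr0n R).
  have m1 : (0 < m)%N by rewrite -(ltr0n R).
  have mNR : m%:R <= N%:R :> R by rewrite ler_nat ltnW.
  pose r := L / m%:R.
  have Hr' : H <= r.
    by rewrite /r ler_pdivlMr// /L mulrC ler_wpM2r// ltW.
  have r_gt0 : 0 < r by exact: lt_le_trans Hr'.
  have mr : m%:R * r = L by rewrite /r; field; rewrite gt_eqF.
  have ry : 2 * r <= y.
    apply: le_trans ay; rewrite -(ler_pM2l m_gt0) mulrCA mr /L.
    have := ler_wpM2r (ltW a_gt0) (ltW m4).
    by have := ler_wpM2l (ltW H_gt0) Na; lra.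
  have -> : m%:R * theta = pi / (2 * r).
    by rewrite /theta -mr; field; rewrite !gt_eqF.
  have Ar : 0 < A r by apply: A0; exact: ltW.
  pose rho := Num.max (mean F w - c / A r) 0.
  have tb : 64 * b0 * (pi / (2 * r)) <= 1.
    rewrite [leLHS]mulrA ler_pdivrMr; last exact: mulr_gt0.
    rewrite mul1r.
    have b0' : 0 <= 64 * b0 by rewrite mulr_ge0// (le_trans ler01).
    by have := ler_wpM2l b0' pi4; lra.
  have w1r z : 0 <= z -> z <= 2 * r -> 1 <= w z.
    by move=> z0 zr; apply: w1 => //; exact: le_trans ry.
  have cmin : c / A r <=
      Num.min (2^-1 * fine (F `]r, 2 * r]%classic)) (w0 / 128).
    rewrite le_min; apply/andP; split.
      have : cw / A r <= fine (F `]r, 2 * r]%classic).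
        by apply: Hw; exact: le_trans Hr'.
      have : c / A r <= cw / 2 / A r.
        by rewrite ler_wpM2r ?invr_ge0 ?(ltW Ar)// ge_min lexx.
      by rewrite (_ : cw / 2 / A r = 2^-1 * (cw / A r)); [lra|ring].
    have Ah := scale_ge_half hA (ltW r_gt0).
    rewrite ler_pdivrMr//.
    have cw256 : c <= w0 / 256 by rewrite ge_min lexx orbT.
    by have := ler_wpM2l (ltW w0_gt0) Ah; lra.
  apply: (@le_trans _ _ (rho ^+ n)).
    apply: iter_step_cos => //; first by rewrite le_max lexx orbT.
    move=> u v uv.
    apply: (le_trans (phase_defect bw wge0 (ltW w0_gt0) ww0 central r_gt0 w1r
      tb uv)).
    by rewrite le_max; apply/orP; left; rewrite lerD2l lerN2.
  have DAr : m%:R `^ (alpha / 2) * A r <= D * n%:R.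
    have s0r : s0 <= r by exact: le_trans Hr'.
    have /andP[+ _] := HA r m%:R s0r mR; rewrite mr => /le_trans; apply.
    rewrite -An; apply: le_trans (HD a (ltW a_gt0)).
    apply: (scale_le hA); first exact: ltW.
    have := ler_wpM2l (ltW H_gt0) Na.
    by rewrite mulrA [H * 2]mulrC [H * _]mulrC.
  have dec : c / D * m%:R `^ (alpha / 2) <= n%:R * (c / A r).
    have D0 : 0 < D by exact: lt_le_trans D1.
    rewrite mulrA ler_pdivlMr// -[leLHS]mulrA.
    apply: (le_trans (ler_wpM2l (ltW cD) DAr)).
    by rewrite mulrA divfK ?gt_eqF// mulrC.
  apply: (@le_trans _ _ (expR (M / n%:R - c / A r) ^+ n)).
    rewrite ler_pXn2r ?nnegrE ?expR_ge0//; last by rewrite le_max lexx orbT.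
    rewrite ge_max expR_ge0 andbT.
    apply: le_trans (expR_ge1Dx _); lra.
  rewrite -expRM_natl mulrBr (_ : n%:R * (M / n%:R) = M); last first.
    by field; rewrite gt_eqF.
  have HQ : Q1 <= Num.max Q1 ((4 * H + 1) ^+ 2) by rewrite le_max lexx.
  rewrite expRD; apply: le_trans (Qm _ HQ).
  rewrite ler_wpM2l ?expR_ge0//; apply: le_trans (HQ1 m m1).
  by rewrite ler_expR lerN2.
apply: (@le_trans _ _ (8 / N%:R * (Q * 2))).
  rewrite ler_wpM2l ?divr_ge0//.
  rewrite /q -mulr_sumr ler_wpM2l//; exact: sum_inv_sqr_le.
rewrite (_ : 8 / N%:R * (Q * 2) = 16 * Q / N%:R); last by ring.
apply: ler_wpM2l; first exact: mulr_ge0.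
by rewrite lef_pV2 ?posrE// ltW.
Qed.

End Concentration.

(** * Local large deviations *)

Section LocalLargeDeviations.
Context (R : realType) (alpha p : R) (A : R -> R).
Variable F : probability (measurableTypeR R) R.
Hypothesis halpha : (0 < alpha < 1) || (1 < alpha < 2).
Hypothesis hA : normalized_scale alpha A.
Hypothesis hp : 0 < p.
Hypothesis hright :
  asymp_equiv (fun x => fine (F `]x, +oo[%classic)) (fun x => p / A x).
Variables CR CL : R.
Hypothesis CR1 : 1 <= CR.
Hypothesis CL1 : 1 <= CL.
Hypothesis right_tail :
  forall x, 0 <= x -> fine (F `]x, +oo[%classic) <= CR / A x.
Hypothesis left_tail :
  forall x, 0 <= x -> fine (F `]-oo, - x]%classic) <= CL / A x.
Hypothesis hmean :
  1 < alpha -> ('E_F[fun y : measurableTypeR R => (y : R)] = 0)%E.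
Variable h : R.
Hypothesis h0 : 0 <= h.

Let A0 (s : R) : 0 <= s -> 0 < A s. Proof. exact: (scale_gt0 hA). Qed.
Let alpha0 : 0 < alpha. Proof. exact: (alpha_gt0 halpha). Qed.
Let a n := scale_inv A n%:R.
Let a1 n : (1 <= n)%N -> 1 <= a n.
Proof. by move=> n1; case: (scale_inv_spec alpha0 hA n1). Qed.
Let a_gt0 n : (1 <= n)%N -> 0 < a n.
Proof. by move=> n1; apply: lt_le_trans (a1 n1). Qed.
Let Aa n : (1 <= n)%N -> A (a n) = n%:R.
Proof. by move=> n1; case: (scale_inv_spec alpha0 hA n1). Qed.

Let window (x : R) : R -> R := \1_(`[x - h, x + h]).
Let below (y : R) : R -> R := \1_(`]-oo, y]).
Let above (y : R) : R -> R := \1_(`]y, +oo[).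

Let bmfun_window x : bmfun (window x).
Proof. by apply: bmfun_indic; exact: measurable_itv. Qed.
Let bmfun_below y : bmfun (below y).
Proof. by apply: bmfun_indic; exact: measurable_itv. Qed.
Let bmfun_above y : bmfun (above y).
Proof. by apply: bmfun_indic; exact: measurable_itv. Qed.
Let bmfun_one : bmfun ((fun=> 1) : R -> R).
Proof. exact: bmfun_cst. Qed.
Let window_ge0 x z : 0 <= window x z. Proof. by []. Qed.
Let belowE y z : below y z = (z <= y)%R%:R.
Proof. by rewrite /below indicE mem_setE in_itv. Qed.
Let below_ge0 y z : 0 <= below y z.
Proof. by []. Qed.
Let below_le1 y z : below y z <= 1.
Proof. by rewrite belowE lern1 leq_b1. Qed.
Let aboveE y z : above y z = (y < z)%R%:R.
Proof. by rewrite /above indicE mem_setE in_itv/= andbT. Qed.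
Let windowE x z : window x z = (x - h <= z <= x + h)%R%:R.
Proof. by rewrite /window indicE mem_setE in_itv. Qed.

#[local] Opaque bmfun step mean.

(** Increments reweighted by [expR (lam * z)] reweight a path by the
exponential of [lam] times its displacement. *)
Lemma iter_step_tilt (lam y : R) (f : R -> R) (n : nat) (s : R) : 0 <= lam ->
  bmfun f ->
  iter n (step F (tilt lam y)) (fun s => expR (- (lam * s)) * f s) s =
  expR (- (lam * s)) * iter n (step F (below y)) f s.
Proof.
move=> l0 bf; elim: n s => [//|n IH] s; rewrite !iterS.
rewrite !stepE -meanZ; last first.
  by apply: bmfun_step_integrand => //; exact: bmfun_iter_step.
congr mean; apply/funext => z; rewrite IH /tilt -/(below y z).
rewrite (_ : - (lam * (s + z)) = - (lam * s) - lam * z); last by ring.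
by rewrite expRD expRN expRN; field; rewrite !gt_eqF ?expR_gt0.
Qed.

Let concentrated : exists2 K, 0 <= K & forall n x s, (1 <= n)%N ->
  iter n (step F (fun=> 1)) (window x) s <= K / a n.
Proof.
have [b0 b01 central] := central_mass alpha0 hA CR1 CL1 right_tail left_tail.
have [K K0 HK] :=
  concentration alpha0 hA b01 central hp hright h0 ltr01 (lexx 0).
exists K => // n x s n1.
apply: (HK n (a n) (fun=> 1) n1 (lexx _) bmfun_one) => //.
by rewrite mean_const mul0r addr0.
Qed.

Let concentrated_pred : exists2 K, 0 <= K & forall n x s, (1 <= n)%N ->
  iter n.-1 (step F (fun=> 1)) (window x) s <= K / a n.
Proof.
have [K K0 HK] := concentrated.
have [C C1 HC] := scale_inv_succ alpha0 hA.
have a10 := a_gt0 (leqnn 1).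
exists (K * C + a 1).
  by rewrite addr_ge0 ?(ltW a10)// mulr_ge0// (le_trans ler01).
move=> [//|[|n]] x s _ /=.
  rewrite ler_pdivlMr// (@le_trans _ _ (a 1))//.
    rewrite ler_piMl ?(ltW a10)// windowE; by case: (_ && _).
  by rewrite lerDr mulr_ge0// (le_trans ler01).
apply: (le_trans (HK n.+1 x s _)) => //.
have an := a_gt0 (ltn0Sn n); have an2 := a_gt0 (ltn0Sn n.+1).
rewrite ler_pdivrMr// mulrAC ler_pdivlMr//.
apply: (@le_trans _ _ (K * (C * a n.+1))).
  by rewrite ler_wpM2l//; exact: HC.
by rewrite mulrA ler_wpM2r ?(ltW an)// lerDl ltW.
Qed.

Let log_scale_le : exists Lam y0, [/\ 0 <= Lam, 1 <= y0 &
  forall y, y0 <= y -> ln (A y) <= Lam * y].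
Proof.
have al1 : alpha < alpha + 1 by rewrite ltrDl.
have [s0 s01 HA] := scale_potter alpha0 hA alpha0 al1.
have s0_gt0 : 0 < s0 by exact: lt_le_trans s01.
have As0 : 0 < A s0 by apply: A0; exact: ltW.
exists (alpha + 1 + A s0), s0; split => //.
  by rewrite !addr_ge0// ltW.
move=> y s0y; have y_gt0 : 0 < y by exact: lt_le_trans s0y.
have y1 : 1 <= y by exact: le_trans s0y.
have ys : 1 <= y / s0 by rewrite ler_pdivlMr// mul1r.
have ys0 : 0 < y / s0 by exact: divr_gt0.
have /andP[_] := HA s0 (y / s0) (lexx _) ys; rewrite divfK ?gt_eqF// => Ay.
have Ay0 : 0 < A y by apply: A0; exact: ltW.
have : ln (A y) <= ln ((y / s0) `^ (alpha + 1) * A s0).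
  by rewrite ler_ln ?posrE ?mulr_gt0 ?powR_gt0.
move=> /le_trans; apply; rewrite lnM ?posrE ?powR_gt0// ln_powR [leRHS]mulrDl.
apply: lerD.
  rewrite ler_wpM2l ?addr_ge0 ?(ltW alpha0)//.
  apply: (le_trans (ltW (ln_sublinear ys0))).
  by rewrite ler_pdivrMr// ler_peMr// ltW.
apply: (le_trans (ltW (ln_sublinear As0))).
by rewrite ler_peMr// ltW.
Qed.

(** Tilting by [lam = ln (A y / n) / y] gains the factor
[expR (- lam * k * y) = (n / A y) ^+ k], keeps the total mass of [n] steps
bounded, and leaves the walk as spread out as before. *)
Lemma truncated_local (k : nat) : exists K y0, [/\ 0 <= K, 1 <= y0 &
  forall n y, (1 <= n)%N -> y0 <= y -> n%:R <= A y ->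
  iter n (step F (below y)) (window (k%:R * y)) 0 <=
  K / a n * (n%:R / A y) ^+ k].
Proof.
have [b0 b01 central] := central_mass alpha0 hA CR1 CL1 right_tail left_tail.
have [M [y1 [M0 y11 HM]]] :=
  tilted_mass halpha hA CR1 CL1 right_tail left_tail hmean.
have [Lam [y2 [Lam0 y21 HL]]] := log_scale_le.
have [K K0 HK] := concentration alpha0 hA b01 central hp hright h0
  (expR_gt0 (- (Lam * b0))) M0.
exists (expR (Lam * h) * K), (Num.max (Num.max y1 y2) b0); split.
- by rewrite mulr_ge0// expR_ge0.
- by rewrite !le_max y11.
move=> n y n1; rewrite !ge_max => /andP[/andP[y1y y2y] b0y] nA.
have nR : (0 : R) < n%:R by rewrite ltr0n.
have y_ge1 : 1 <= y by exact: le_trans y1y.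
have y_gt0 : 0 < y by exact: lt_le_trans y_ge1.
have Ay : 0 < A y by apply: A0; exact: ltW.
pose B := A y / n%:R.
have B1 : 1 <= B by rewrite /B ler_pdivlMr// mul1r.
have B0 : 0 < B by exact: lt_le_trans B1.
pose lam := ln B / y.
have l0 : 0 <= lam by rewrite /lam divr_ge0 ?ln_ge0// ltW.
have lL : lam <= Lam.
  rewrite /lam ler_pdivrMr// (le_trans _ (HL y y2y))// ler_ln ?posrE//.
  by rewrite /B ler_pdivrMr// ler_peMr ?(ltW Ay)// ler1n.
set x := k%:R * y.
have Ebound z : window x z * expR (- (lam * z)) <=
    expR (- (lam * (x - h))) * window x z.
  rewrite mulrC windowE; case: (boolP (_ && _)) => [/andP[zx _]|_].
    by rewrite !mulr1 ler_expR lerN2 ler_wpM2l.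
  by rewrite !mulr0.
have bE : bmfun (fun z => window x z * expR (- (lam * z))).
  apply: (@bmfun_indicM _ _ _ _ _ (expR (- (lam * (x - h))))).
  - exact: measurable_itv.
  - under [fun _ => _]funext do rewrite -mulNr.
    exact: measurable_expRM.
  move=> z /=; rewrite in_itv/= => /andP[zx _].
  by rewrite gtr0_norm ?expR_gt0// ler_expR lerN2 ler_wpM2l.
have bw : bmfun (tilt lam y) by exact: bmfun_tilt.
have w0 z : 0 <= tilt lam y z.
  by rewrite tiltE; case: ifP => // _; exact: expR_ge0.
have := @iter_step_tilt lam y (window x) n 0 l0 (bmfun_window x).
rewrite mulr0 oppr0 expR0 mul1r => <-.
under [X in iter _ _ X]funext do rewrite mulrC.
apply: (@le_trans _ _ (expR (- (lam * (x - h))) *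
    iter n (step F (tilt lam y)) (window x) 0)).
  rewrite -iter_stepZ//; apply: le_iter_step => //.
  - exact: (bmfunM (bmfun_cst _ (expR (- (lam * (x - h))))) (bmfun_window x)).
  - by move=> z; rewrite mulr_ge0// expR_ge0.
have conc : iter n (step F (tilt lam y)) (window x) 0 <= K / a n.
  apply: (HK n y (tilt lam y) n1 _ bw w0).
  - by apply: (scale_lt_le hA); [exact: ltW|rewrite -/(a n) Aa].
  - by move=> z z0 zy; rewrite tiltE zy -expR0 ler_expR mulr_ge0.
  - move=> z zb bz; rewrite tiltE (le_trans bz b0y) ler_expR.
    have b00 : 0 <= b0 by exact: le_trans b01.
    apply: (@le_trans _ _ (lam * - b0)); last by rewrite ler_wpM2l.
    by rewrite mulrN lerN2 ler_wpM2r.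
  - apply: (le_trans (HM y B y1y B1)); rewrite lerD2l.
    rewrite le_eqVlt; apply/orP; left; apply/eqP.
    by rewrite /B; field; rewrite !gt_eqF.
apply: (le_trans (ler_wpM2l (expR_ge0 _) conc)).
have -> : expR (- (lam * (x - h))) = expR (lam * h) * (n%:R / A y) ^+ k.
  rewrite (_ : - (lam * (x - h)) = lam * h + k%:R * - (lam * y)); last first.
    by rewrite /x; ring.
  rewrite expRD expRM_natl; congr (_ * _ ^+ _).
  rewrite /lam divfK ?gt_eqF// expRN lnK ?posrE//.
  by rewrite /B invf_div.
have nA0 : 0 <= (n%:R / A y) ^+ k.
  by apply: exprn_ge0; apply: divr_ge0 => //; exact: ltW.
have Ka0 : 0 <= K / a n by rewrite divr_ge0// ltW// a_gt0.
rewrite -[leLHS]mulrA [X in _ * X]mulrC mulrA -(mulrA _ K).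
rewrite ler_wpM2r// ler_wpM2r//.
by rewrite ler_expR ler_wpM2r.
Qed.


Let jump_le (u g : R -> R) (G y : R) : bmfun u -> bmfun g -> 0 <= y -> 0 <= G ->
  (forall z, u z * g z <= G * above y z) -> step F u g 0 <= G * (CR / A y).
Proof.
move=> bu bg y0 G0 ug.
apply: (@le_trans _ _ (mean F (fun z => G * above y z))).
  rewrite stepE; apply: le_mean; [exact: bmfun_step_integrand| |].
    exact: (bmfunM (bmfun_cst _ G) (bmfun_above y)).
  by move=> z; rewrite add0r.
rewrite meanZ; last exact: bmfun_above.
apply: ler_wpM2l => //; rewrite /above mean_indic; last exact: measurable_itv.
exact: right_tail.
Qed.

Let ratio_ge0 n x : 0 <= x -> 0 <= n%:R / A x.
Proof. by move=> x0; rewrite divr_ge0// ltW// A0. Qed.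

(** Either all increments are at most [x / k], which the truncated bound
covers, or some increment exceeds [x / k], which the hypothesis covers. *)
Lemma one_jump (k : nat) (Y : R) : (0 < k)%N ->
  exists2 K, 0 <= K & forall n x J (W : R -> R), (1 <= n)%N -> 0 <= x ->
    0 <= J -> bmfun W -> (forall z, 0 <= W z) -> (forall z, W z <= 1) ->
    (Y <= x / k%:R ->
      n%:R * step F (fun z => W z * above (x / k%:R) z)
                    (iter n.-1 (step F W) (window x)) 0 <=
      J / a n * (n%:R / A x) ^+ k) ->
    iter n (step F W) (window x) 0 <= (K + J) / a n * (n%:R / A x) ^+ k.
Proof.
move=> k0; have kR : (0 : R) < k%:R by rewrite ltr0n.
have k1 : (1 : R) <= k%:R by rewrite ler1n.
have [K1 K10 HK1] := concentrated.
have [K2 [y0 [K20 y01 HK2]]] := truncated_local k.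
have [D D1 HD] := scale_doubling alpha0 hA k1.
have D0 : 0 <= D by exact: le_trans D1.
pose Y' := Num.max y0 Y.
have Y1 : 1 <= Y' by rewrite le_max y01.
have Y0 : 0 <= Y' by exact: le_trans Y1.
have AY1 : 1 <= A Y' by exact: (scale_ge1 hA Y1).
have AY0 : 0 <= A Y' by exact: le_trans AY1.
pose E := D * A Y'.
have E0 : 0 <= E by rewrite mulr_ge0.
have K1E : 0 <= K1 * E ^+ k by rewrite mulr_ge0// exprn_ge0.
have K2D : 0 <= K2 * D ^+ k by rewrite mulr_ge0// exprn_ge0.
exists (K1 * E ^+ k + K2 * D ^+ k); first exact: addr_ge0.
move=> n x J W n1 x0 J0 bW W0 W1 HJ.
have Ax := A0 x0; have an := a_gt0 n1.
have nR : (0 : R) < n%:R by rewrite ltr0n.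
have n1R : (1 : R) <= n%:R by rewrite ler1n.
have r0 : 0 <= (n%:R / A x) ^+ k by rewrite exprn_ge0// ratio_ge0.
have xk0 : 0 <= x / k%:R by rewrite divr_ge0// ltW.
have Axk := HD _ xk0; rewrite [k%:R * _]mulrC divfK ?gt_eqF// in Axk.
(* if [x] is bounded or [n / A x] bounded below, concentration suffices *)
have [small|] := boolP ((x / k%:R < Y') || (A (x / k%:R) < n%:R)).
  have AE : A x <= E * n%:R.
    apply: (le_trans Axk); rewrite /E -mulrA ler_wpM2l//.
    case/orP: small => [xY|/ltW An]; last first.
      by rewrite (le_trans An)// ler_peMl// ltW.
    apply: (@le_trans _ _ (A Y')).
      by apply: (scale_le hA) => //; exact: ltW.
    by rewrite ler_peMr.
  apply: (@le_trans _ _ (K1 / a n)).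
    apply: le_trans (HK1 n x 0 n1).
    exact: (le_iter_step F n 0 bW bmfun_one (bmfun_window x) (bmfun_window x)
      W0 W1 (window_ge0 x) (fun=> lexx _)).
  apply: (@le_trans _ _ (K1 * E ^+ k / a n * (n%:R / A x) ^+ k)).
    rewrite (_ : K1 * E ^+ k / a n * (n%:R / A x) ^+ k =
      K1 / a n * (E * n%:R / A x) ^+ k); last by rewrite !exprMn; ring.
    rewrite ler_peMr ?divr_ge0 ?(ltW an)// exprn_ege1//.
    by rewrite ler_pdivlMr// mul1r.
  rewrite ler_wpM2r// ler_wpM2r ?invr_ge0 ?(ltW an)// -addrA lerDl.
  exact: addr_ge0.
rewrite negb_or -!leNgt => /andP[Yx nA].
have YY' : Y <= Y' by rewrite le_max lexx orbT.
have {}HJ := HJ (le_trans YY' Yx).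
have Yx' : y0 <= x / k%:R by apply: le_trans Yx; rewrite le_max lexx.
set y := x / k%:R in Yx Yx' nA HJ Axk xk0 *.
have xE : x = k%:R * y by rewrite /y mulrC divfK ?gt_eqF.
pose v z := W z * below y z; pose u z := W z * above y z.
have bv : bmfun v by exact: (bmfunM bW (bmfun_below y)).
have bu : bmfun u by exact: (bmfunM bW (bmfun_above y)).
have v0 z : 0 <= v z by rewrite mulr_ge0.
have u0 z : 0 <= u z by rewrite mulr_ge0.
have vW z : v z <= W z.
  by rewrite /v belowE; case: (z <= y)%R; rewrite ?mulr1 ?mulr0.
have vb z : v z <= below y z by rewrite ler_piMl.
have Wvu z : W z <= v z + u z.
  rewrite /v /u belowE aboveE -mulrDr; case: (leP z y) => _.
    by rewrite addr0 mulr1.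
  by rewrite add0r mulr1.
apply: (le_trans (iter_step_decomposition F n 0 bW bv bu (bmfun_window x)
  v0 u0 (window_ge0 x) vW Wvu)).
rewrite [leRHS](_ : _ = (K1 * E ^+ k + K2 * D ^+ k) / a n * (n%:R / A x) ^+ k +
  J / a n * (n%:R / A x) ^+ k); last by ring.
apply: lerD; last exact: HJ.
apply: (le_trans (le_iter_step F n 0 bv (bmfun_below y) (bmfun_window x)
  (bmfun_window x) v0 vb (window_ge0 x) (fun=> lexx _))).
rewrite {1}xE; apply: (le_trans (HK2 n y n1 Yx' nA)).
apply: (@le_trans _ _ (K2 * D ^+ k / a n * (n%:R / A x) ^+ k)); last first.
  by rewrite ler_wpM2r// ler_wpM2r ?invr_ge0 ?(ltW an)// lerDr.
have Ay : 0 < A y by exact: A0.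
rewrite (_ : K2 * D ^+ k / a n * (n%:R / A x) ^+ k =
  K2 / a n * (D * (n%:R / A x)) ^+ k); last by rewrite !exprMn; ring.
rewrite ler_wpM2l ?divr_ge0 ?(ltW an)//.
have Dq0 := mulr_ge0 D0 (ratio_ge0 n x0).
rewrite ler_pXn2r ?nnegrE ?ratio_ge0//.
rewrite ler_pdivrMr// (_ : D * (n%:R / A x) * A y = n%:R * (D * A y) / A x).
  by rewrite ler_pdivlMr// ler_wpM2l// ltW.
by ring.
Qed.

(** The case [k = 1] of one_jump: wherever a first jump beyond [x] ends, the
remaining walk hits the window with probability of order at most [1 / a_n]. *)
Lemma local_deviation : exists2 C, 0 <= C & forall n x, (1 <= n)%N -> 0 <= x ->
  iter n (step F (fun=> 1)) (window x) 0 <= C / a n * (n%:R / A x).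
Proof.
have [K K0 HK] := one_jump 0 (leqnn 1).
have [K' K'0 HK'] := concentrated_pred.
have CR0 : 0 <= CR by exact: le_trans CR1.
exists (K + K' * CR); first by rewrite addr_ge0// mulr_ge0.
move=> n x n1 x0; have := HK n x (K' * CR) (fun=> 1) n1 x0.
rewrite !expr1 !divr1; apply => //; first by rewrite mulr_ge0.
move=> _.
have G0 : 0 <= K' / a n by rewrite divr_ge0// ltW// a_gt0.
have bi : bmfun (iter n.-1 (step F (fun=> 1)) (window x)).
  exact: bmfun_iter_step.
have ba : bmfun (fun z => 1 * above x z) by exact: (bmfunM bmfun_one).
have := jump_le ba bi x0 G0; set T := step _ _ _ _ => HT.
apply: (@le_trans _ _ (n%:R * (K' / a n * (CR / A x)))).
  rewrite ler_wpM2l//; apply: HT => z.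
  rewrite mul1r mulrC ler_wpM2r ?HK'//.
by rewrite le_eqVlt; apply/orP; left; apply/eqP; ring.
Qed.

(** A first jump [z] in [(x / (k + 1), gamma * x]] leaves the remaining walk
the distance [x - z >= (1 - gamma) * x] to cover with increments bounded by
[gamma * x <= gamma / (1 - gamma) * (x - z)], and [1 / gamma] decreases by
one in this way. *)
Lemma truncated_local_deviation (k : nat) (gamma : R) : 0 < gamma ->
  gamma * k%:R < 1 -> exists2 C, 0 <= C & forall n x, (1 <= n)%N -> 0 <= x ->
  iter n (step F (below (gamma * x))) (window x) 0 <=
  C / a n * (n%:R / A x) ^+ k.+1.
Proof.
elim: k gamma => [|k IH] gamma g0 gk.
  have [C C0 HC] := local_deviation.
  exists C => // n x n1 x0; rewrite expr1; apply: le_trans (HC n x n1 x0).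
  exact: (le_iter_step F n 0 (bmfun_below (gamma * x)) bmfun_one
    (bmfun_window x) (bmfun_window x) (below_ge0 _) (below_le1 _)
    (window_ge0 x) (fun=> lexx _)).
have k1 : (1 : R) <= k.+1%:R by rewrite ler1n.
have g1 : gamma < 1.
  by apply: le_lt_trans gk; rewrite ler_peMr// ltW.
have g1' : 0 < 1 - gamma by rewrite subr_gt0.
pose gamma' := gamma / (1 - gamma).
have g'0 : 0 < gamma' by exact: divr_gt0.
have g'k : gamma' * k%:R < 1.
  rewrite /gamma' mulrAC ltr_pdivrMr// mul1r; move: gk.
  by rewrite -natr1 mulrDr mulr1; lra.
have [C C0 HC] := IH gamma' g'0 g'k.
have Dk1 : (1 : R) <= k.+2%:R by rewrite ler1n.
have [Dk Dk1' HDk] := scale_doubling alpha0 hA Dk1.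
have Dk0 : 0 <= Dk by exact: le_trans Dk1'.
have inv1 : 1 <= (1 - gamma)^-1.
  by rewrite invf_ge1//; lra.
have [D D1 HD] := scale_doubling alpha0 hA inv1.
have D0 : 0 <= D by exact: le_trans D1.
have [Cs Cs1 HCs] := scale_inv_succ alpha0 hA.
have Cs0 : 0 <= Cs by exact: le_trans Cs1.
have CR0 : 0 <= CR by exact: le_trans CR1.
have [K K0 HK] := one_jump (h / (1 - gamma) + 1) (ltn0Sn k.+1).
pose J := C * Cs * D ^+ k.+1 * (CR * Dk).
have J0 : 0 <= J by rewrite !mulr_ge0// exprn_ge0.
exists (K + J); first exact: addr_ge0.
move=> n x n1 x0.
apply: (HK _ _ _ _ n1 x0 J0 (bmfun_below _) (below_ge0 _) (below_le1 _)).
move=> xlarge; set y := x / k.+2%:R in xlarge *.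
have kR : (0 : R) < k.+2%:R by rewrite ltr0n.
have yx : y <= x by rewrite /y ler_pdivrMr// ler_peMr.
have y0 : 0 <= y by rewrite /y divr_ge0// ltW.
have Ay := A0 y0; have Ax := A0 x0; have an := a_gt0 n1.
have Axy : A x <= Dk * A y.
  by have := HDk _ y0; rewrite /y mulrC divfK ?gt_eqF.
have hx : gamma * x < x - h.
  have : h < x * (1 - gamma).
    rewrite -ltr_pdivrMr//; apply: lt_le_trans yx.
    by apply: lt_le_trans xlarge; rewrite ltrDl.
  by lra.
pose G := C * Cs / a n * (D * (n%:R / A x)) ^+ k.+1.
have G0 : 0 <= G.
  apply: mulr_ge0; first by rewrite divr_ge0 ?mulr_ge0// ltW.
  by rewrite exprn_ge0// mulr_ge0// ratio_ge0.
have bi : bmfun (iter n.-1 (step F (below (gamma * x))) (window x)).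
  exact: bmfun_iter_step.
have bu : bmfun (fun z => below (gamma * x) z * above y z).
  exact: (bmfunM (bmfun_below _) (bmfun_above _)).
have := jump_le bu bi y0 G0; set T := step _ _ _ _ => HT.
apply: (@le_trans _ _ (n%:R * (G * (CR / A y)))); last first.
  rewrite (_ : J / a n * (n%:R / A x) ^+ k.+2 =
    n%:R * (G * (CR * Dk / A x))); last first.
    rewrite /J /G [(n%:R / A x) ^+ k.+2]exprS [in RHS]exprMn.
    by set e := (_ / _) ^+ _; ring.
  rewrite ler_wpM2l// ler_wpM2l// -[leRHS]mulrA ler_wpM2l//.
  by rewrite ler_pdivlMr// mulrC ler_pdivrMr.
rewrite ler_wpM2l//; apply: HT => z.
rewrite belowE aboveE.
case: (leP z (gamma * x)) => zg; last by rewrite !mul0r mulr_ge0.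
case: (ltP y z) => yz; last by rewrite mulr0 mul0r mulr0.
rewrite !mul1r mulr1.
clear T bi; case: n n1 an @G G0 => [//|[_ an G G0|n _ an G G0]].
  (* a single jump, of size at most [gamma * x], misses the window *)
  by rewrite /= windowE (lt_geF (le_lt_trans zg hx)).
rewrite -[n.+2.-1]/n.+1.
have xz : (1 - gamma) * x <= x - z by lra.
have xz0 : 0 <= x - z by apply: le_trans xz; rewrite mulr_ge0// ltW.
have gxz : gamma * x <= gamma' * (x - z).
  rewrite /gamma' mulrAC ler_pdivlMr// -mulrA ler_wpM2l ?(ltW g0)//.
  by rewrite mulrC.
rewrite -[X in iter _ _ _ X](add0r z) -iter_step_shift.
rewrite (_ : (fun t => window x (t + z)) = window (x - z)); last first.
  apply/funext => t; rewrite !windowE; congr ((nat_of_bool _)%:R).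
  by apply/idP/idP; lra.
apply: (@le_trans _ _ (iter n.+1 (step F (below (gamma' * (x - z))))
    (window (x - z)) 0)).
  apply: (le_iter_step F n.+1 0 (bmfun_below _) (bmfun_below _)
    (bmfun_window (x - z)) (bmfun_window (x - z)) (below_ge0 _) _
    (window_ge0 _) (fun=> lexx _)) => t.
  by apply: le_indic => s /=; rewrite !in_itv/= => /le_trans; apply.
apply: (le_trans (HC n.+1 (x - z) (ltn0Sn n) xz0)).
have an1 := a_gt0 (ltn0Sn n).
apply: ler_pM.
- by rewrite divr_ge0// ltW.
- by rewrite exprn_ge0// ratio_ge0.
- rewrite ler_pdivrMr// mulrAC ler_pdivlMr// -mulrA ler_wpM2l//.
  exact: HCs.
have Dq0 := mulr_ge0 D0 (ratio_ge0 n.+2 x0).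
rewrite ler_pXn2r ?nnegrE ?ratio_ge0//.
have Axz : 0 < A (x - z) by exact: A0.
have AA : A x <= D * A (x - z).
  have gx0 : 0 <= (1 - gamma) * x by rewrite mulr_ge0// ltW.
  have := HD _ gx0; rewrite mulrA mulVf ?gt_eqF// mul1r => /le_trans; apply.
  by rewrite ler_wpM2l//; apply: (scale_le hA).
rewrite ler_pdivrMr//.
rewrite (_ : D * (n.+2%:R / A x) * A (x - z) = n.+2%:R * (D * A (x - z)) / A x).
  by rewrite ler_pdivlMr//; apply: ler_pM; rewrite ?ler_nat// ltW.
by ring.
Qed.

End LocalLargeDeviations.

Section Events.
Context (R : realType) (F : probability (measurableTypeR R) R).
Context d (T : measurableType d) (P : probability T R).
Context (X : nat -> {RV P >-> R}) (iidX : iid F X).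
Variables (J : set R) (h : R).
Hypothesis mJ : measurable J.
Hypothesis Jh : forall y, J y -> `|y| <= h.

Lemma measurable_translate (x : R) : measurable (translate x J).
Proof.
rewrite (_ : translate x J = (fun z : R => z - x) @^-1` J).
  by rewrite -[X in measurable X]setTI; apply: measurable_funB.
apply/seteqP; split => z /=; first by move=> [y Jy <-]; rewrite addrC addKr.
by move=> Jz; exists (z - x) => //; rewrite addrC subrK.
Qed.

Lemma running_max_le n (c : R) (t : T) : (1 <= n)%N ->
  running_max X n t <= c <-> forall i, (i < n)%N -> X i t <= c.
Proof.
move=> n1; split => [/bigmax_leP[_ H] i ni|H].
  exact: (H (Ordinal ni)).
by apply/bigmax_leP; split => [|i _]; exact: H.
Qed.

Lemma iter_indic_translate_le (w : R -> R) (n : nat) (x : R) :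
  bmfun w -> (forall z, 0 <= w z) ->
  iter n (step F w) \1_(translate x J) 0 <=
  iter n (step F w) \1_(`[x - h, x + h]) 0.
Proof.
move=> bw w0; apply: le_iter_step => //.
- by apply: bmfun_indic; exact: measurable_translate.
- by apply: bmfun_indic; exact: measurable_itv.
- move=> z; apply: le_indic => _ [y /Jh + <-] /=.
  by rewrite in_itv/= ler_norml => /andP[? ?]; apply/andP; split; lra.
Qed.

Lemma truncated_event_le n (x c : R) : (1 <= n)%N ->
  (P [set w | translate x J (walk X n w) /\ (running_max X n w <= c)%R] <=
   (iter n (step F \1_(`]-oo, c])) \1_(`[x - h, x + h]) 0)%:E)%E.
Proof.
move=> n1; have mc : measurable (`]-oo, c]%classic : set R).
  exact: measurable_itv.
rewrite (_ : [set w | _] = [set t | (forall i, (i < n)%N ->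
    `]-oo, c]%classic (X i t)) /\ translate x J (walk X n t)]).
  rewrite (walk_law iidX mc n (measurable_translate x)) lee_fin.
  apply: iter_indic_translate_le => //.
  exact: bmfun_indic.
apply/seteqP; split => t /= [].
  by move=> tJ /(running_max_le c t n1) H; split.
move=> H tJ; split => //; apply/(running_max_le c t n1) => i /H.
by rewrite /= in_itv.
Qed.

Lemma event_le n (x : R) :
  (P [set w | translate x J (walk X n w)] <=
   (iter n (step F (fun=> 1)) \1_(`[x - h, x + h]) 0)%:E)%E.
Proof.
rewrite (_ : [set w | _] = [set t | (forall i, (i < n)%N ->
    setT (X i t)) /\ translate x J (walk X n t)]); last first.
  by apply/seteqP; split => t /= => [|[]//].
rewrite (walk_law iidX measurableT n (measurable_translate x)) lee_fin.
have -> : \1_setT = (fun=> 1) :> (R -> R).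
  by apply/funext => z; rewrite indicE in_setT.
by apply: iter_indic_translate_le => //; exact: bmfun_cst.
Qed.

End Events.

Theorem theorem1p1 (R : realType) (alpha p q : R) (A : R -> R)
  (F : probability (measurableTypeR R) R)
  (halpha : (0 < alpha < 1) || (1 < alpha < 2))
  (hRV : regularly_varying alpha A)
  (hA : normalized_scale alpha A)
  (hp : 0 < p) (hq : 0 <= q)
  (hright : asymp_equiv (fun x => fine (F `]x, +oo[%classic)) (fun x => p / A x))
  (hleft : if q == 0
           then asymp_negligible (fun x => fine (F `]-oo, - x]%classic))
                  (fun x => 1 / A x)
           else asymp_equiv (fun x => fine (F `]-oo, - x]%classic))
                  (fun x => q / A x))
  (hmean : 1 < alpha -> ('E_F[fun y : measurableTypeR R => (y : R)] = 0)%E)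
  (J : set R) (hJm : measurable J) (hJb : bounded_set (J : set R^o)) :
  (forall gamma : R, 0 < gamma ->
    exists C0 : R,
      forall (d : measure_display) (T : measurableType d) (P : probability T R)
             (X : nat -> {RV P >-> R}), iid F X ->
      forall (n : nat) (x : R), (1 <= n)%N -> 0 <= x ->
        (P [set w | translate x J (walk X n w) /\
                    (running_max X n w <= gamma * x)%R]
         <= (C0 * (1 / scale_inv A n%:R)
             * (n%:R / A x) ^+ `|Num.ceil (1 / gamma)|)%:E)%E) /\
  (exists C0' : R,
      forall (d : measure_display) (T : measurableType d) (P : probability T R)
             (X : nat -> {RV P >-> R}), iid F X ->
      forall (n : nat) (x : R), (1 <= n)%N -> 0 <= x ->
        (P [set w | translate x J (walk X n w)]
         <= (C0' * (1 / scale_inv A n%:R) * (n%:R / A x))%:E)%E).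
Proof.
have alpha0 := alpha_gt0 halpha.
have [CR CR1 right_tail] := right_tail_le hA hp hright.
have [CL CL1 left_tail] : exists2 C, 1 <= C &
    forall x, 0 <= x -> fine (F `]-oo, - x]%classic) <= C / A x.
  have le1 x : fine (F `]-oo, - x]%classic) <= 1 by exact: fine_prob_le1.
  move: hleft; case: eqP => [_|/eqP q0 H].
    exact: (tail_le hA ltr01 le1).
  by apply: (tail_le hA _ le1 H); rewrite lt_neqAle eq_sym q0.
have [h h1 Jh] := near_pinfty_ex hJb.
have h0 : 0 <= h by exact: le_trans h1.
have {}Jh y : J y -> `|y| <= h by exact: Jh.
split.
  move=> gamma gamma0.
  have inv0 : 0 < 1 / gamma by rewrite divr_gt0.
  pose k := `|Num.ceil (1 / gamma)|%N.
  have c0 : 0 < Num.ceil (1 / gamma) by rewrite ceil_gt0.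
  have k0 : (0 < k)%N by rewrite absz_gt0 gt_eqF.
  have kE : k.-1%:R = (Num.ceil (1 / gamma) - 1)%:~R :> R.
    rewrite -subn1 natrB// rmorphB/=; congr (_ - _).
    by rewrite /k natr_absz gtr0_norm.
  have gk : gamma * k.-1%:R < 1.
    rewrite kE mulrC -ltr_pdivlMr//.
    by have /andP[] := ceil_itv (1 / gamma).
  have [C C0 HC] := truncated_local_deviation halpha hA hp hright CR1 CL1
    right_tail left_tail hmean h0 gamma0 gk.
  exists C => d T P X iidX n x n1 x0.
  apply: (le_trans (truncated_event_le iidX hJm Jh x (gamma * x) n1)).
  rewrite lee_fin; apply: (le_trans (HC n x n1 x0)).
  by rewrite prednK// div1r.
have [C C0 HC] := local_deviation halpha hA hp hright CR1 CL1
  right_tail left_tail hmean h0.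
exists C => d T P X iidX n x n1 x0.
apply: (le_trans (event_le iidX hJm Jh n x)).
by rewrite lee_fin; apply: (le_trans (HC n x n1 x0)); rewrite div1r.
Qed.
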